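(* Let $W=(W_t)_{t\ge0}$ be a standard Brownian motion and let $f:\mathbb{R}\to\mathbb{R}$. The following assertions are equivalent: (i) $f$ is a measurable solution of the quadratic functional equation $f(x+y)+f(x-y)=2f(x)+2f(y)$ for all $x,y\in\mathbb{R}$; (ii) $f$ is a measurable even function with $f(0)=0$ such that $f(W_t)$ is integrable for every $t\ge0$ and the process $N_t=f(W_t)-E f(W_t)$, $t\ge0$, is a right-continuous martingale; (iii) $f(x)=ax^2$ for all $x\in\mathbb{R}$, for some constant $a\in\mathbb{R}$.
   Context: $W$ is a standard Brownian motion on a complete probability space $(\Omega,\mathcal{F},P)$, and $(\mathcal{F}_t)_{t\ge0}$ is the filtration generated by $W$; ''martingale'' means martingale with respect to this filtration. *)

(* Defs.v *)
From HB Require Import structures.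
From mathcomp Require Import all_boot all_order all_algebra.
From mathcomp Require Import all_classical all_reals all_analysis.
Set Implicit Arguments. Unset Strict Implicit. Unset Printing Implicit Defensive.
Import Order.TTheory GRing.Theory Num.Theory.
Import numFieldNormedType.Exports.
Local Open Scope classical_set_scope.
Local Open Scope ring_scope.

Section BM.
Context {d : measure_display} {T : measurableType d} {R : realType}.
Variable P : probability T R.

Definition natural_filtration (W : R -> T -> R) (s : R) : set (set T) :=
  <<s [set A | exists u B, 0 <= u <= s /\ measurable B /\
                           A = W u @^-1` B] >>.

Definition standard_brownian_motion (W : R -> T -> R) : Prop :=
  [/\ (forall t, 0 <= t -> measurable_fun setT (W t)),
      (forall w, W 0 w = 0),
      (forall w, {within [set t | 0 <= t], continuous (fun t => W t w)}),
      (forall s t, 0 <= s -> s < t -> forall B, measurable B ->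
         P [set w | W t w - W s w \in B] =
         normal_prob 0 (Num.sqrt (t - s)) B)
    &
      (forall (n : nat) (tt : nat -> R), 0 <= tt 0%N ->
         (forall i, (i < n)%N -> tt i < tt i.+1) ->
         forall (B : nat -> set R), (forall i, measurable (B i)) ->
         P (\bigcap_(i in [set i | (i < n)%N])
               [set w | W (tt i.+1) w - W (tt i) w \in B i]) =
         (\prod_(i < n) P [set w | (W (tt i.+1) w - W (tt i) w)%R \in B i])%E)].

Definition martingale (F : R -> set (set T)) (N : R -> T -> R) : Prop :=
  [/\ (forall t, 0 <= t -> forall B, measurable B -> F t (N t @^-1` B)),
      (forall t, 0 <= t -> P.-integrable setT (fun w => (N t w)%:E))
    & (forall s t, 0 <= s -> s <= t -> forall A, F s A ->
         (\int[P]_(w in A) (N t w)%:E = \int[P]_(w in A) (N s w)%:E)%E)].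

Definition right_continuous_paths (N : R -> T -> R) : Prop :=
  forall w t, 0 <= t -> (fun u => N u w) @ at_right t --> N t w.

End BM.

(* Main.v *)
Require Import Defs.
From HB Require Import structures.
From mathcomp Require Import all_boot all_order all_algebra.
From mathcomp Require Import all_classical all_reals all_analysis measurable_realfun.
From mathcomp Require Import ring lra.
Set Implicit Arguments. Unset Strict Implicit. Unset Printing Implicit Defensive.
Import Order.TTheory GRing.Theory Num.Theory.
Import numFieldNormedType.Exports.
Local Open Scope classical_set_scope.
Local Open Scope ring_scope.

(** (iii) => (ii).  A pi-lambda argument makes [W t - W s] independent of the
    past up to time [s], whence the martingale property of
    [W t ^+ 2 - E (W t ^+ 2)].

    (ii) => (iii).  Put [g t = E (f (W t))].  Testing the martingale property on
    the events [W s \in B] gives, for all [s, h > 0] and almost every [x],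
      E (f (x + sqrt h Z)) = f x + (g (s + h) - g s),   Z standard normal.
    The increment of [g] thus does not depend on [s]; being additive and locally
    bounded it is [c * h].  The left-hand side is continuous in [x], so [f]
    agrees almost everywhere with a continuous even function [F] such that
    [E (F (x + sqrt h Z)) = F x + c * h] for every [x].  If
    [c - b * E (Z ^ 2) > 0], then [F x - b * x ^+ 2] has no local maximum,
    because Gaussian tails are negligible against [h] as [h] tends to 0; on
    [[- x, x]] its maximum is therefore attained at the endpoints.  Applied to
    [F] and [- F], with [b] tending to [c / E (Z ^ 2)], this gives
    [F x = F 0 + c / E (Z ^ 2) * x ^+ 2].  The exceptional null set is removed
    by right-continuity: some path hits a given [x] at a positive time while
    avoiding the null set at all positive rational times.

    (i) => (iii).  A measurable solution is bounded on [[-1, 1]]; after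
    subtraction of [f 1 * x ^+ 2] it vanishes at the integers, hence grows at
    most linearly, whereas [f (n x) = n ^+ 2 * f x]. *)

(** * Lebesgue measure under affine maps *)

Definition image_measure d1 d2 (T1 : measurableType d1) (T2 : measurableType d2)
    (R : realFieldType) (m : {measure set T1 -> \bar R}) (f : T1 -> T2)
    (mf : measurable_fun setT f) : {measure set T2 -> \bar R} :=
  measure_function_pushforward__canonical__measure_function_Measure m mf.

(** Uniqueness of Lebesgue measure: the rescaled image measure has the right value on half-open
    intervals. A negative [a] exchanges the ends, so the preimage is closed on the left instead; its
    length is the same. *)
Lemma lebesgue_measure_affine (R : realType) (a b : R) (A : set R) :
  a != 0 -> measurable A ->
  (`|a|%:E * lebesgue_measure ((fun z : R => (b + a * z)%R) @^-1` A) =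
   lebesgue_measure A)%E.
Proof.
move=> a0 mA.
have mphi : measurable_fun [set: measurableTypeR R]
    (fun z : measurableTypeR R => (b + a * z)%R : measurableTypeR R).
  by apply: measurable_funD => //; apply: measurable_funM.
pose nu := [the {measure set (measurableTypeR R) -> \bar R} of
  mscale (NngNum (normr_ge0 a)) (image_measure lebesgue_measure mphi)].
suff H X : ocitv X -> lebesgue_measure X = nu X.
  have := lebesgue_measure_unique H mA. move=> ->. by [].
case=> [[x y]] _ <-.
rewrite /nu /= /mscale /= /pushforward /=.
rewrite (_ : (fun z => b + a * z) @^-1` `]x, y] =
  if 0 < a then `](x - b) / a, (y - b) / a]%classic
           else `[(y - b) / a, (x - b) / a[%classic).
  case: ifP => ha.
    rewrite !lebesgue_measure_itv/= !lte_fin ltr_pM2r ?invr_gt0// ltrD2r.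
    case: ifPn => xy; last by rewrite mule0.
    rewrite -!EFinD -EFinM; congr EFin.
    rewrite gtr0_norm//; field.
    by rewrite a0.
  have {}ha : a < 0 by rewrite lt_neqAle a0 leNgt ha.
  rewrite !lebesgue_measure_itv/= !lte_fin ltr_nM2r ?invr_lt0// ltrD2r.
  case: ifPn => xy; last by rewrite mule0.
  rewrite -!EFinD -EFinM; congr EFin.
  rewrite ltr0_norm//; field.
  by rewrite a0.
apply/seteqP; case: ifP => ha.
  split => z /=; rewrite !in_itv/= ler_pdivlMr// ltr_pdivrMr//;
   by rewrite lerBrDr ltrBlDr ![z * a]mulrC ![a * z + b]addrC.
have {}ha : a < 0 by rewrite lt_neqAle a0 leNgt ha.
split => z /=; rewrite !in_itv/= ler_ndivrMr// ltr_ndivlMr//;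
  by rewrite lerBrDr ltrBlDr ![z * a]mulrC ![a * z + b]addrC andbC.
Qed.

(** * Measures with a density, Gaussian laws *)

Section density.
Local Open Scope ereal_scope.
Context d (T : measurableType d) (R : realType).
Variables (mu nu : {measure set T -> \bar R}) (p : T -> R).
Hypothesis mp : measurable_fun setT p.
Hypothesis p0 : forall x, (0 <= p x)%R.
Hypothesis nuE : forall A, measurable A -> nu A = \int[mu]_(x in A) (p x)%:E.
Import HBNNSimple.

Let ge0_integral_density_nnsfun (f : {nnsfun T >-> R}) :
  \int[nu]_x (f x)%:E = \int[mu]_x ((f x)%:E * (p x)%:E).
Proof.
have mpE : measurable_fun setT (EFin \o p) by exact/measurable_EFinP.
under [LHS]eq_integral do rewrite fimfunE -fsumEFin//.
rewrite [LHS]ge0_integral_fsum//; last 2 first.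
  - by move=> r; exact/measurable_EFinP/measurableT_comp.
  - by move=> n x _; rewrite EFinM nnfun_muleindic_ge0.
under [RHS]eq_integral.
  move=> x xD; rewrite fimfunE -fsumEFin// muleC ge0_mule_fsumr; last first.
    by move=> r; rewrite EFinM nnfun_muleindic_ge0.
  over.
have mi r : measurable_fun [set: T]
    (fun x => (r * \1_(f @^-1` [set r]) x)%:E : \bar R).
  by apply/measurable_EFinP; apply: measurable_funM.
rewrite [RHS]ge0_integral_fsum//; last 2 first.
  - by move=> r; apply: emeasurable_funM.
  - move=> n x _; rewrite EFinM mule_ge0 ?lee_fin//.
    by rewrite -lee_fin EFinM nnfun_muleindic_ge0.
apply: eq_fsbigr => r _.
rewrite integralZl_indic_nnsfun//= integral_indic// setIT nuE//.
(* For [r < 0] the level set is empty, because the simple function is nonnegative. *)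
have [r0|r0] := leP 0%R r; last first.
  rewrite preimage_nnfun0// integral_set0 mule0; apply/esym.
  by apply: integral0_eq => x _; rewrite indicE in_set0 mulr0 mule0.
rewrite -ge0_integralZl//; last by move=> x _; rewrite lee_fin.
  rewrite [LHS]integral_mkcond; apply: eq_integral => x _.
  rewrite patchE indicE; case: ifPn => _; rewrite ?mulr0 ?mule0// mulr1.
  by rewrite muleC.
exact: measurable_funTS.
Qed.

(** Monotone convergence, on both sides, along simple functions increasing to [f]. *)
Lemma ge0_integral_density (f : T -> \bar R) :
  measurable_fun setT f -> (forall x, 0 <= f x) ->
  \int[nu]_x f x = \int[mu]_x (f x * (p x)%:E).
Proof.
move=> mf f0.
have mpE : measurable_fun setT (EFin \o p) by exact/measurable_EFinP.
pose f_ := nnsfun_approx measurableT mf.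
transitivity (limn (fun n => \int[nu]_x (f_ n x)%:E)).
  rewrite -monotone_convergence//=.
  - apply: eq_integral => ? /[!inE] xD; apply/esym/cvg_lim => //=.
    exact: cvg_nnsfun_approx.
  - by move=> n; exact/measurable_EFinP/measurable_funTS.
  - by move=> n ? _; rewrite lee_fin.
  - by move=> ? _ ? ? mn; rewrite lee_fin; exact/lefP/nd_nnsfun_approx.
transitivity (limn (fun n => \int[mu]_x ((f_ n x)%:E * (p x)%:E))).
  by congr (limn _); apply/funext => n; exact: ge0_integral_density_nnsfun.
rewrite -monotone_convergence//=.
- apply: eq_integral => x _; apply/cvg_lim => //=.
  apply: cvgeZr => //; exact: cvg_nnsfun_approx.
- by move=> n; apply: emeasurable_funM => //; apply/measurable_EFinP.
- by move=> n ? _; rewrite mule_ge0 ?lee_fin.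
- move=> x _ m n mn; apply: lee_wpmul2r; rewrite ?lee_fin//.
  exact/lefP/nd_nnsfun_approx.
Qed.

Lemma integrable_density (f : T -> \bar R) : measurable_fun setT f ->
  nu.-integrable setT f <-> mu.-integrable setT (fun x => f x * (p x)%:E).
Proof.
move=> mf.
have mpE : measurable_fun setT (EFin \o p) by exact/measurable_EFinP.
have E : \int[nu]_x `|f x| = \int[mu]_x `|f x * (p x)%:E|.
  rewrite ge0_integral_density//; last exact: measurableT_comp.
  by apply: eq_integral => x _; rewrite abseM (@gee0_abs _ (p x)%:E) ?lee_fin.
split=> /integrableP[_ h]; apply/integrableP; split=> //.
- exact: emeasurable_funM.
- by rewrite -E.
- by rewrite E.
Qed.

Lemma integral_density (f : T -> \bar R) : nu.-integrable setT f ->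
  \int[nu]_x f x = \int[mu]_x (f x * (p x)%:E).
Proof.
move=> intf; have mf := measurable_int _ intf.
rewrite integralE [RHS]integralE.
congr (_ - _); rewrite ge0_integral_density//.
- by apply: eq_integral => x _; rewrite !funeposE maxe_pMl ?lee_fin// mul0e.
- exact: measurable_funepos.
- by apply: eq_integral => x _; rewrite !funenegE -mulNe maxe_pMl ?lee_fin// mul0e.
- exact: measurable_funeneg.
Qed.

End density.

(** * Affine changes of variables in Gaussian integrals *)

Section affine_change_of_variables.
Context {R : realType}.
Local Notation mu := (@lebesgue_measure R).
Implicit Types (a b m s : R) (A : set R).

Lemma measurable_affine a b : measurable_fun setT (fun z : R => b + a * z).
Proof. by apply: measurable_funD => //; apply: measurable_funM. Qed.

Lemma ge0_integral_affine a b A (f : R -> \bar R) :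
  a != 0 -> measurable A -> measurable_fun setT f -> (forall x, 0 <= f x)%E ->
  (\int[mu]_(x in A) f x =
   `|a|%:E * \int[mu]_(z in (fun z : R => (b + a * z)%R) @^-1` A) f (b + a * z)%R)%E.
Proof.
move=> a0 mA mf f0.
have mphi : measurable_fun [set: measurableTypeR R]
    (fun z : measurableTypeR R => (b + a * z)%R : measurableTypeR R).
  exact: measurable_affine.
pose nu := [the {measure set (measurableTypeR R) -> \bar R} of
  mscale (NngNum (normr_ge0 a)) (image_measure lebesgue_measure mphi)].
transitivity (\int[nu]_(x in A) f x)%E.
  apply: eq_measure_integral => B mB _.
  exact/esym/lebesgue_measure_affine.
rewrite ge0_integral_mscale//=; last exact: measurable_funTS.
by congr (_ * _)%E; rewrite ge0_integral_pushforward//; exact: measurable_funTS.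
Qed.

(** Allowing [s < 0] makes the reflection of the line an instance of the affine change of
    variables. *)
Lemma normal_pdf_affine m s z : s != 0 ->
  normal_pdf 0 1 z = `|s| * normal_pdf m s (m + s * z).
Proof.
move=> s0; rewrite !normal_pdfE ?oner_eq0//.
rewrite /normal_peak /normal_fun subr0 [m + _]addrC addrK mulrA; congr (_ * _).
  rewrite -[_ *+ 2 in RHS]mulrnAr sqrtrM ?sqr_ge0// expr1n mul1r sqrtr_sqr.
  by rewrite invfM mulrA divff ?normr_eq0// mul1r.
congr expR; rewrite exprMn expr1n.
by field.
Qed.

Lemma normal_prob_affine m s A : s != 0 -> measurable A ->
  normal_prob m s A = normal_prob 0 1 ((fun z : R => m + s * z) @^-1` A).
Proof.
move=> s0 mA; rewrite /normal_prob (@ge0_integral_affine s m)//; last 2 first.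
- by apply/measurable_EFinP; exact: measurable_normal_pdf.
- by move=> x; rewrite lee_fin normal_pdf_ge0.
have mA' : measurable ((fun z : R => m + s * z) @^-1` A).
  by rewrite -[X in measurable X]setTI; apply: measurable_affine.
rewrite -ge0_integralZl//; last 2 first.
- apply/measurable_EFinP; apply: measurable_funTS.
  apply: (measurableT_comp (measurable_normal_pdf m s)).
  exact: measurable_affine.
- by move=> z _; rewrite lee_fin normal_pdf_ge0.
by apply: eq_integral => z _; rewrite -EFinM (normal_pdf_affine m z s0).
Qed.

Lemma integrable_normal_affine m s (f : R -> \bar R) : s != 0 ->
  measurable_fun setT f ->
  (normal_prob m s).-integrable setT f <->
  (normal_prob 0 1).-integrable setT (fun z => f (m + s * z)%R).
Proof.
move=> s0 mf.
have mphi : measurable_fun [set: measurableTypeR R]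
    (fun z : measurableTypeR R => (m + s * z)%R : measurableTypeR R).
  exact: measurable_affine.
have mfphi : measurable_fun setT (fun z => f (m + s * z)%R).
  exact: measurableT_comp.
have E : (\int[normal_prob m s]_x `|f x| =
  \int[normal_prob 0 1]_z `|f (m + s * z)%R|)%E.
  transitivity (\int[image_measure (normal_prob 0 1) mphi]_x `|f x|)%E.
    by apply: eq_measure_integral => B mB _; exact: normal_prob_affine.
  by rewrite ge0_integral_pushforward//; exact: measurableT_comp.
split=> /integrableP[_ h]; apply/integrableP; split.
- exact: mfphi.
- by rewrite -E.
- exact: mf.
- by rewrite E.
Qed.

Lemma integral_normal_affine m s (f : R -> \bar R) : s != 0 ->
  (normal_prob m s).-integrable setT f ->
  (\int[normal_prob m s]_x f x =
   \int[normal_prob 0 1]_z f (m + s * z)%R)%E.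
Proof.
move=> s0 intf; have mf := measurable_int _ intf.
have mphi : measurable_fun [set: measurableTypeR R]
    (fun z : measurableTypeR R => (m + s * z)%R : measurableTypeR R).
  exact: measurable_affine.
transitivity (\int[image_measure (normal_prob 0 1) mphi]_x f x)%E.
  by apply: eq_measure_integral => B mB _; exact: normal_prob_affine.
have h := (integrable_normal_affine m s0 mf).1 intf.
by rewrite integral_pushforward.
Qed.

Lemma integrable_normalP m s (f : R -> R) : measurable_fun setT f ->
  (normal_prob m s).-integrable setT (EFin \o f) <->
  mu.-integrable setT (fun x => (f x * normal_pdf m s x)%:E).
Proof.
move=> mf; apply: integrable_density => //.
- exact: measurable_normal_pdf.
- by move=> x; exact: normal_pdf_ge0.
- exact/measurable_EFinP.
Qed.

Lemma Rintegral_normal m s (f : R -> R) :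
  (normal_prob m s).-integrable setT (EFin \o f) ->
  \int[normal_prob m s]_x f x = \int[mu]_x (f x * normal_pdf m s x).
Proof.
move=> intf; rewrite /Rintegral.
rewrite (@integral_density _ _ R mu (normal_prob m s) (normal_pdf m s))//.
- exact: measurable_normal_pdf.
- by move=> x; exact: normal_pdf_ge0.
Qed.

End affine_change_of_variables.

(** * Integrability against all Gaussian laws *)

Section gaussian_integrability.
Context {R : realType}.
Local Notation mu := (@lebesgue_measure R).
Implicit Types (f v F : R -> R) (m s x y c : R).

(** All means are included because the mean value identity is centred at arbitrary points, although
    Brownian motion directly supplies centred laws only. *)
Definition gauss_integrable f := forall m s, 0 < s ->
  (normal_prob m s).-integrable setT (EFin \o f).

Lemma normal_peakM k s : 0 < k -> normal_peak (k * s) = normal_peak s / k.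
Proof.
move=> k0; rewrite /normal_peak exprMn -!mulrnAr -mulrA.
rewrite sqrtrM ?sqr_ge0// sqrtr_sqr gtr0_norm//.
by rewrite invfM mulrC.
Qed.

(** Doubling the deviation absorbs a shift of the mean: after the factor [2] has paid for the ratio
    of the peaks, the difference of the exponents is a sum of two squares. *)
Lemma normal_pdf_le m s y : 0 < s ->
  normal_pdf m s y <= 2 * expR (m ^+ 2 / (4 * s ^+ 2)) * normal_pdf 0 (2 * s) y.
Proof.
move=> s0; have s20 : 2 * s != 0 by rewrite mulf_neq0// gt_eqF.
rewrite !normal_pdfE ?gt_eqF ?mulr_gt0// normal_peakM// /normal_fun subr0.
rewrite [leRHS](_ : _ = normal_peak s * (expR (m ^+ 2 / (4 * s ^+ 2)) *
   expR (- y ^+ 2 / ((2 * s) ^+ 2 *+ 2)))); last by field.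
rewrite -expRD ler_wpM2l ?normal_peak_ge0// ler_expR -subr_ge0.
rewrite [leRHS](_ : _ =
  (2 * (y - m) ^+ 2 + (y - 2 * m) ^+ 2) / (8 * s ^+ 2)); last first.
  by field; rewrite gt_eqF.
by rewrite divr_ge0 ?addr_ge0 ?(@mulr_ge0 _ 2) ?(@mulr_ge0 _ 8) ?sqr_ge0.
Qed.

Lemma le_integrable_normal m s m' s' (K : R) f (g : R -> R) : measurable_fun setT f ->
  (forall y, `|f y| * normal_pdf m s y <= K * (`|g y| * normal_pdf m' s' y)) ->
  measurable_fun setT g ->
  (normal_prob m' s').-integrable setT (EFin \o g) ->
  (normal_prob m s).-integrable setT (EFin \o f).
Proof.
move=> mf fg mg /(integrable_normalP m' s' mg) ig.
apply/(integrable_normalP m s mf).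
apply: (le_integrable _ _ _ (integrableZl _ K ig)) => //.
  apply/measurable_EFinP; apply: measurable_funM => //.
  exact: measurable_normal_pdf.
move=> y _ /=; rewrite lee_fin normrM (ger0_norm (normal_pdf_ge0 _ _ _)).
apply: (le_trans (fg y)).
rewrite !normrM (ger0_norm (normal_pdf_ge0 m' _ _)).
by rewrite ler_wpM2r ?ler_norm// mulr_ge0 ?normal_pdf_ge0.
Qed.

Lemma gauss_integrable_centered f : measurable_fun setT f ->
  (forall s, 0 < s -> (normal_prob 0 s).-integrable setT (EFin \o f)) ->
  gauss_integrable f.
Proof.
move=> mf intf m s s0.
apply: (@le_integrable_normal m s 0 (2 * s)
  (2 * expR (m ^+ 2 / (4 * s ^+ 2))) f f) => //.
- by move=> y; rewrite mulrCA ler_wpM2l// normal_pdf_le.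
- by apply: intf; rewrite mulr_gt0.
Qed.

(** Dominated convergence, the density being continuous in its mean. *)
Lemma continuous_normal_mean f s : 0 < s -> measurable_fun setT f ->
  gauss_integrable f -> continuous (fun m => \int[normal_prob m s]_x f x).
Proof.
move=> s0 mf intf.
rewrite (_ : (fun _ => _) =
  fun m => \int[mu]_x (f x * normal_pdf m s x)); last first.
  by apply/funext => m; exact/Rintegral_normal/intf.
move=> a.
(* The constant of [normal_pdf_le] at the largest mean allowed, [|m| <= |a| + 1], so that one
   dominating function serves all [m] near [a]. *)
pose K := 2 * expR ((`|a| + 1) ^+ 2 / (4 * s ^+ 2)).
have a1 : a \in `]a - 1, a + 1[%classic.
  by rewrite inE/= in_itv/= ltrDl ltrBlDl ltrDr ltr01.
apply: (@continuity_under_integral R _ _ mu (fun m x => f x * normal_pdf m s x)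
  setT measurableT (a - 1) (a + 1) _ _
  (fun x => K * (`|f x| * normal_pdf 0 (2 * s) x))) => //.
- by move=> x _; apply/(integrable_normalP x s mf)/intf.
- apply: aeW => x _ m _; apply: cvgM; first exact: cvg_cst.
  rewrite normal_pdfE ?gt_eqF// /normal_fun.
  under [X in X @ _ --> _]eq_fun do rewrite normal_pdfE ?gt_eqF//.
  apply: cvgM; first exact: cvg_cst.
  apply: (cvg_comp _ expR); last exact: continuous_expR.
  apply: cvgM; last exact: cvg_cst.
  apply: cvgN; apply: (cvg_comp (fun m => x - m) (fun x => x ^+ 2)).
    by apply: cvgB; [exact: cvg_cst|exact: cvg_id].
  exact: sqr_continuous.
- rewrite (_ : EFin \o _ =
      fun x => (K%:E * (`|f x| * normal_pdf 0 (2 * s) x)%:E)%E)//.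
  apply: integrableZl => //.
  apply/(integrable_normalP 0 (2 * s) (f := fun x => `|f x|)).
    exact: measurableT_comp.
  by apply: integrable_norm; apply: intf; rewrite mulr_gt0.
- move=> m; rewrite /= in_itv/= => /andP[am ma]; apply: aeW => y _.
  rewrite normrM (ger0_norm (normal_pdf_ge0 _ _ _)) mulrCA ler_wpM2l//.
  apply: (le_trans (normal_pdf_le m y s0)).
  rewrite ler_wpM2r ?normal_pdf_ge0// ler_wpM2l// ler_expR.
  rewrite ler_wpM2r ?invr_ge0 ?(@mulr_ge0 _ 4) ?sqr_ge0//.
  rewrite -[m ^+ 2]real_normK ?num_real// lerXn2r ?nnegrE ?addr_ge0//.
  have := ler_normD a (m - a); rewrite [a + _]addrC subrK => /le_trans; apply.
  by rewrite lerD2l ler_norml; lra.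
Qed.

End gaussian_integrability.

(** * First and second Gaussian moments *)

Section gaussian_moments.
Context {R : realType}.
Local Notation mu := (@lebesgue_measure R).
Implicit Types (f v F : R -> R) (m s x y c : R).

Lemma gauss_integrableD f g : gauss_integrable f -> gauss_integrable g ->
  gauss_integrable (fun x => f x + g x).
Proof. by move=> iF ig m s s0; exact: integrableD (iF _ _ s0) (ig _ _ s0). Qed.

Lemma gauss_integrableZ k f : gauss_integrable f ->
  gauss_integrable (fun x => k * f x).
Proof. by move=> iF m s s0; exact: integrableZl (iF _ _ s0). Qed.

Lemma integrable_prob_cst d (T : measurableType d) (P : probability T R) c :
  P.-integrable setT (EFin \o (fun _ : T => c)).
Proof. exact: finite_measure_integrable_cst. Qed.

Lemma Rintegral_prob_cst d (T : measurableType d) (P : probability T R) c :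
  \int[P]_x c = c.
Proof. by rewrite Rintegral_cst// [X in fine X]probability_setT mulr1. Qed.

Lemma gauss_integrable_cst c : gauss_integrable (fun _ => c).
Proof. by move=> m s s0; exact: integrable_prob_cst. Qed.

Lemma gauss_integrable_sqr : gauss_integrable (fun x => x ^+ 2).
Proof.
apply: gauss_integrable_centered; first exact: measurable_funX.
move=> s s0.
apply: (@le_integrable_normal _ 0 s 0 (2 * s) (8 * s ^+ 2) _ (fun=> 1)) => //;
  last first.
- exact: integrable_prob_cst.
-   move=> y; rewrite normr1 mul1r !normal_pdfE ?gt_eqF ?mulr_gt0// normal_peakM//.
rewrite ger0_norm ?sqr_ge0// /normal_fun subr0.
(* [w] is the gain in the exponent when [s] becomes [2 * s]. Since [expR w >= w], and
   [4 * s ^+ 2 * w] is [3 / 2 * y ^+ 2], this gain absorbs the factor [y ^+ 2]. *)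
set w := 3 * y ^+ 2 / (8 * s ^+ 2).
have -> : expR (- y ^+ 2 / ((2 * s) ^+ 2 *+ 2)) =
    expR (- y ^+ 2 / (s ^+ 2 *+ 2)) * expR w.
  by rewrite -expRD; congr expR; rewrite /w; field; rewrite gt_eqF.
rewrite [leRHS](_ : _ = 4 * s ^+ 2 * expR w *
  (normal_peak s * expR (- y ^+ 2 / (s ^+ 2 *+ 2)))); last by field.
rewrite ler_wpM2r ?mulr_ge0 ?normal_peak_ge0 ?expR_ge0//.
apply: (@le_trans _ _ (4 * s ^+ 2 * w)); last first.
  rewrite ler_wpM2l//; first by rewrite (@mulr_ge0 _ 4) ?sqr_ge0.
  by apply: le_trans (expR_ge1Dx _); rewrite lerDr.
rewrite [leRHS](_ : _ = y ^+ 2 * (3 / 2)).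
  by rewrite ler_peMr ?sqr_ge0//; lra.
by rewrite /w; field; rewrite gt_eqF.
Qed.

Lemma gauss_integrable_id : gauss_integrable (fun x : R => x).
Proof.
apply: gauss_integrable_centered => // s s0.
have /integrable_normalP h := gauss_integrableD (gauss_integrable_cst 1)
  gauss_integrable_sqr 0 s0.
apply: (@le_integrable_normal _ 0 s 0 s 1 _ (fun x => 1 + x ^+ 2)) => //.
- move=> y; rewrite mul1r ler_wpM2r ?normal_pdf_ge0//.
  rewrite [leRHS]ger0_norm ?addr_ge0 ?sqr_ge0//= -[y ^+ 2]real_normK ?num_real//.
  by have := sqr_ge0 (`|y| - 1); nra.
- by apply: measurable_funD => //; exact: measurable_funX.
- exact: gauss_integrableD (gauss_integrable_cst 1) gauss_integrable_sqr 0 s s0.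
Qed.

Lemma Rintegral_normal_affine m s f : 0 < s -> measurable_fun setT f ->
  gauss_integrable f ->
  \int[normal_prob m s]_x f x = \int[normal_prob 0 1]_z f (m + s * z).
Proof.
move=> s0 mf intf.
have E := integral_normal_affine (lt0r_neq0 s0) (intf m s s0).
by rewrite /Rintegral E.
Qed.

(** Only the square of the deviation enters the density, so deviations [1] and [-1] give the same
    integrals; the affine change of variables with factor [-1] then reflects [f]. *)
Lemma Rintegral_normal_opp f : measurable_fun setT f -> gauss_integrable f ->
  \int[normal_prob 0 1]_z f (- z) = \int[normal_prob 0 1]_z f z.
Proof.
move=> mf intf.
have N1 : (normal_prob 0 (-1)).-integrable setT (EFin \o f).
  apply: (@le_integrable_normal _ 0 (-1) 0 1 1 f f) => //; last exact: intf.
  move=> y; rewrite mul1r !normal_pdfE ?oppr_eq0 ?oner_eq0//.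
  by rewrite /normal_peak /normal_fun sqrrN.
have -> : \int[normal_prob 0 1]_z f z = \int[normal_prob 0 (-1)]_z f z.
  rewrite (Rintegral_normal (intf 0 1 ltr01)) (Rintegral_normal N1).
  congr (Rintegral _ _ _); apply/funext => x.
  rewrite !normal_pdfE ?oppr_eq0 ?oner_eq0//.
  by rewrite /normal_peak /normal_fun sqrrN.
have N10 : -1 != 0 :> R by rewrite oppr_eq0 oner_eq0.
have E := integral_normal_affine N10 N1.
rewrite [RHS]/Rintegral E.
by congr fine; apply: eq_integral => z _; rewrite /= add0r mulN1r.
Qed.

(** The second moment of the standard normal law, kept symbolic; [gauss_var_gt0] allows division by
    it. *)
Definition gauss_var : R := \int[normal_prob 0 1]_z (z ^+ 2).

Lemma Rintegral_normal01_id : \int[normal_prob 0 1]_z z = 0 :> R.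
Proof.
have := Rintegral_normal_opp (@measurable_id _ _ _) gauss_integrable_id.
under eq_Rintegral do rewrite -mulN1r.
rewrite RintegralZl//; last exact: gauss_integrable_id.
by move=> h; lra.
Qed.

Lemma Rintegral_normal_id s : 0 < s -> \int[normal_prob 0 s]_z z = 0 :> R.
Proof.
move=> s0; rewrite Rintegral_normal_affine//; last exact: gauss_integrable_id.
under eq_Rintegral do rewrite add0r.
rewrite RintegralZl//; last exact: gauss_integrable_id.
by rewrite Rintegral_normal01_id mulr0.
Qed.

Lemma Rintegral_normal_sqr m s : 0 < s ->
  \int[normal_prob m s]_x (x ^+ 2) = m ^+ 2 + gauss_var * s ^+ 2.
Proof.
move=> s0.
have mX : measurable_fun setT (fun x : R => x ^+ 2) by exact: measurable_funX.
rewrite (Rintegral_normal_affine m s0 mX gauss_integrable_sqr).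
under eq_Rintegral => z _.
  rewrite (_ : _ ^+ 2 = (m ^+ 2 + 2 * m * s * z) + s ^+ 2 * z ^+ 2); last by ring.
  over.
have iid := gauss_integrableZ (2 * m * s) gauss_integrable_id.
have isq := gauss_integrableZ (s ^+ 2) gauss_integrable_sqr.
have ic := gauss_integrable_cst (m ^+ 2).
rewrite RintegralD//; [|exact: gauss_integrableD ic iid 0 1 ltr01|exact: isq].
rewrite RintegralD//; [|exact: ic|exact: iid].
rewrite (RintegralZl _ measurableT (gauss_integrable_sqr 0 ltr01)).
rewrite (RintegralZl _ measurableT (gauss_integrable_id 0 ltr01)).
by rewrite Rintegral_prob_cst Rintegral_normal01_id mulr0 addr0 mulrC.
Qed.

(** If it vanished, [z ^+ 2] would be zero almost surely, so all mass would sit on [[set 0]], which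
    is a null set. *)
Lemma gauss_var_gt0 : 0 < gauss_var.
Proof.
have ge0 : 0 <= gauss_var by apply: Rintegral_ge0 => z _; exact: sqr_ge0.
rewrite lt_neqAle ge0 andbT eq_sym; apply/eqP => V0.
have isq := gauss_integrable_sqr 0 ltr01.
have I0 : (\int[normal_prob 0 1]_z `|(z ^+ 2)%:E| = 0 :> \bar R)%E.
  under eq_integral do rewrite gee0_abs ?lee_fin ?sqr_ge0//.
  by rewrite -[LHS]fineK ?(integrable_fin_num measurableT isq)//; congr EFin.
have [N [mN N0 Nsub]] :=
  (ae_eq_integral_abs (normal_prob 0 1) measurableT (measurable_int _ isq)).1 I0.
have : normal_prob 0 1 setT = 0%E :> \bar R.
  apply/eqP; rewrite -measure_le0.
  apply: (@le_trans _ _ (normal_prob 0 1 (N `|` [set 0]))).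
    apply: le_measure; rewrite ?inE//; first exact: measurableU.
    move=> z _; have [->|z0] := eqVneq z 0; first by right.
    left; apply: Nsub => /= /(_ Logic.I)/= [] /eqP.
    by rewrite sqrf_eq0 (negbTE z0).
  apply: le_trans (measureU2 _ _ _) _ => //.
  rewrite [X in (X + _)%E]N0 add0e.
  rewrite measure_le0; apply/eqP.
  move/null_content_dominatesP: (normal_prob_dominates (0 : R) 1); apply=> //.
  exact: lebesgue_measure_set1.
by rewrite [LHS]probability_setT => /eqP; rewrite onee_eq0.
Qed.

End gaussian_moments.

(** * Functions with the Gaussian mean value property *)

Section mean_value_rigidity.
Context {R : realType}.
Local Notation mu := (@lebesgue_measure R).
Implicit Types (f v F : R -> R) (b m s x y c delta kappa : R).

(* Away from [x] the ratio of the two densities is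
   [s^-1 * exp (- t^2 / 2 * (s^-2 - 1))], and [exp (- w) <= 4 / w^2]. *)
Lemma normal_pdf_tail x s y delta : 0 < s <= 1 / 2 -> 0 < delta ->
  delta <= `|y - x| ->
  normal_pdf x s y <= 64 * s ^+ 3 / delta ^+ 4 * normal_pdf x 1 y.
Proof.
move=> /andP[s0 s12] d0 dy.
rewrite !normal_pdfE ?gt_eqF//.
have -> : normal_peak s = normal_peak 1 / s by rewrite -normal_peakM// mulr1.
rewrite /normal_fun -real_normK ?num_real//.
set t := `|y - x| in dy *.
have t0 : 0 < t by exact: lt_le_trans dy.
set w := t ^+ 2 / 4 / s ^+ 2.
have s20 : 0 < s ^+ 2 by rewrite exprn_gt0.
have w0 : 0 < w by rewrite !divr_gt0// exprn_gt0.
have ew : expR (- w) <= 4 / w ^+ 2.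
  have h : w ^+ 2 / 4 <= expR w.
    rewrite (_ : w = w / 2 + w / 2) ?expRD -?expr2; last by field.
    have := expR_ge1Dx (w / 2); set e := expR _; nra.
  have -> : 4 / w ^+ 2 = (w ^+ 2 / 4)^-1 by rewrite invf_div.
  rewrite expRN lef_pV2 ?posrE ?expR_gt0//.
  by rewrite divr_gt0// exprn_gt0.
(* The exponent is split into that of deviation [1], the term [- w] that yields the polynomial
   bound, and a remainder that is nonpositive because [s <= 1 / 2]. *)
have -> : - t ^+ 2 / (s ^+ 2 *+ 2) =
    - t ^+ 2 / (1 ^+ 2 *+ 2) + (- w - t ^+ 2 * (1 - 2 * s ^+ 2) / (4 * s ^+ 2)).
  by rewrite /w; field; rewrite gt_eqF.
rewrite !expRD.
have e1 : expR (- (t ^+ 2 * (1 - 2 * s ^+ 2) / (4 * s ^+ 2))) <= 1.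
  rewrite -[leRHS]expR0 ler_expR oppr_le0; apply: divr_ge0; last first.
    by rewrite (@mulr_ge0 _ 4) ?sqr_ge0.
  by apply: mulr_ge0; [exact: sqr_ge0|nra].
have w2 : 4 / w ^+ 2 <= 64 * s ^+ 4 / delta ^+ 4.
  rewrite (_ : 4 / w ^+ 2 = 64 * s ^+ 4 / t ^+ 4); last first.
    by rewrite /w; field; rewrite !gt_eqF.
  rewrite ler_wpM2l//; first by rewrite mulr_ge0// exprn_ge0// ltW.
  rewrite lef_pV2 ?posrE ?exprn_gt0//.
  by apply: lerXn2r => //; rewrite nnegrE ltW.
set E := expR (- t ^+ 2 / (1 ^+ 2 *+ 2)).
rewrite (_ : 64 * _ / _ * _ =
    normal_peak 1 / s * (E * (64 * s ^+ 4 / delta ^+ 4))); last first.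
  by field; rewrite !gt_eqF.
rewrite ler_wpM2l//; first by rewrite divr_ge0 ?normal_peak_ge0// ltW.
rewrite ler_wpM2l ?expR_ge0//.
apply: le_trans (le_trans ew w2).
by rewrite ler_piMr ?expR_ge0.
Qed.

(** Within [delta] of [x] the integrand [v y - v x] is nonpositive; beyond, [normal_pdf_tail] makes
    it of order [s ^+ 3]. Hence [kappa * s ^+ 2] is at most a constant times [s ^+ 3], and a small
    [s] excludes [kappa > 0]. *)
Lemma normal_local_max v x delta kappa : measurable_fun setT v ->
  gauss_integrable v -> 0 < delta ->
  (forall y, `|y - x| <= delta -> v y <= v x) ->
  (forall s, 0 < s -> \int[normal_prob x s]_y v y = v x + kappa * s ^+ 2) ->
  kappa <= 0.
Proof.
move=> mv iv d0 vmax hv.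
have iu : gauss_integrable (fun y => v y - v x).
  exact: gauss_integrableD iv (gauss_integrable_cst (- v x)).
have mu' : measurable_fun setT (fun y => v y - v x).
  exact: measurable_funB.
have iau : gauss_integrable (fun y => `|v y - v x|).
  by move=> m s s0; exact: integrable_norm (iu m s s0).
pose C := \int[normal_prob x 1]_y `|v y - v x|.
have C0 : 0 <= C by apply: Rintegral_ge0 => y _.
have key s : 0 < s <= 1 / 2 -> kappa <= 64 / delta ^+ 4 * C * s.
  move=> /andP[s0 s12].
  have s20 : 0 < s ^+ 2 by rewrite exprn_gt0.
  rewrite -(ler_pM2r s20).
  have -> : kappa * s ^+ 2 = \int[normal_prob x s]_y (v y - v x).
    rewrite RintegralB//; [|exact: iv|exact: gauss_integrable_cst].
    by rewrite hv// Rintegral_prob_cst addrC addKr.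
  rewrite (Rintegral_normal (iu x s s0)).
  set K := 64 * s ^+ 3 / delta ^+ 4.
  have K0 : 0 <= K.
    apply: divr_ge0; last by rewrite exprn_ge0// ltW.
    by rewrite mulr_ge0// exprn_ge0// ltW.
  have -> : 64 / delta ^+ 4 * C * s * s ^+ 2 = K * C.
    by rewrite /K; field; rewrite gt_eqF.
  have J : mu.-integrable setT
      (fun y => (`|v y - v x| * normal_pdf x 1 y)%:E).
    apply/(integrable_normalP x 1 (f := fun y => `|v y - v x|)).
      exact: measurableT_comp.
    exact: iau.
  rewrite /C (Rintegral_normal (iau x 1 ltr01)) -RintegralZl//.
  apply: le_Rintegral => //.
  - exact/(integrable_normalP x s mu')/(iu x s s0).
  - exact: (integrableZl measurableT K J).
  move=> y _; have [yd|/ltW yd] := leP `|y - x| delta.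
    apply: (@le_trans _ _ 0).
      by rewrite mulr_le0_ge0 ?normal_pdf_ge0// subr_le0 vmax.
    by rewrite mulr_ge0 ?K0// mulr_ge0 ?normal_pdf_ge0.
  rewrite mulrCA; apply: (@le_trans _ _ (`|v y - v x| * normal_pdf x s y)).
    by rewrite ler_wpM2r ?normal_pdf_ge0 ?ler_norm.
  by rewrite ler_wpM2l// normal_pdf_tail// s0.
rewrite leNgt; apply/negP => k0.
set D := 64 / delta ^+ 4 * C in key.
have D0 : 0 <= D by rewrite mulr_ge0// divr_ge0// exprn_ge0// ltW.
(* The second bound gives [D * s < kappa], contradicting [key]. *)
pose s := Num.min (1 / 2) (kappa / (2 * (D + 1))).
have D1 : 0 < 2 * (D + 1) by rewrite mulr_gt0// ltr_wpDl.
have s0 : 0 < s by rewrite lt_min !divr_gt0.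
have sk : s <= kappa / (2 * (D + 1)) by rewrite ge_min lexx orbT.
have {}sk : s * (2 * (D + 1)) <= kappa by rewrite -ler_pdivlMr.
have s12 : 0 < s <= 1 / 2 by rewrite s0 ge_min lexx.
have := key s s12.
nra.
Qed.

(** The function [v] has the mean value property with the positive constant [c - b * gauss_var], so
    by [normal_local_max] its maximum over [[- x, x]] is not interior. Evenness identifies the two
    endpoints. *)
Lemma even_mean_value_le F b c x : continuous F ->
  (forall y, F (- y) = F y) -> gauss_integrable F ->
  (forall y s, 0 < s -> \int[normal_prob y s]_z F z = F y + c * s ^+ 2) ->
  0 < c - b * gauss_var -> 0 <= x -> F 0 <= F x - b * x ^+ 2.
Proof.
move=> cF eF iF hF cb x0.
pose v y := F y + (- b) * y ^+ 2.
have ib := gauss_integrableZ (- b) (@gauss_integrable_sqr R).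
have cv : continuous v.
  move=> y; apply: cvgD; first exact: cF.
  by apply: cvgM; [exact: cvg_cst|exact: sqr_continuous].
have xx : - x <= x by rewrite (le_trans _ x0)// oppr_le0.
have [z] := EVT_max xx (continuous_subspaceT cv).
rewrite in_itv/= => /andP[z1 z2] zmax.
have F0 : F 0 <= v z.
  by have := zmax 0; rewrite in_itv/= oppr_le0 x0 /v expr0n mulr0 addr0; exact.
have [zx|zx] := ltP `|z| x; last first.
  apply: le_trans F0 _; rewrite /v mulNr.
  have -> : F z = F x.
    have : `|z| = x by apply/eqP; rewrite eq_le zx andbT ler_norml z1.
    by case: (ger0P z) => _ <-; rewrite ?eF.
  rewrite -[z ^+ 2]real_normK ?num_real//.
  by rewrite (_ : `|z| = x)//; apply/eqP; rewrite eq_le zx andbT ler_norml z1.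
suff : c - b * gauss_var <= 0 by rewrite leNgt cb.
(* The radius is the distance from [z] to the nearer endpoint. *)
apply: (@normal_local_max v z (x - `|z|)).
- apply: measurable_funD; first exact: continuous_measurable_fun.
  by apply: measurable_funM => //; exact: measurable_funX.
- exact: gauss_integrableD.
- by rewrite subr_gt0.
- move=> y yz; apply: zmax; rewrite in_itv/= -ler_norml.
  have := ler_normD z (y - z); rewrite addrC subrK.
  by move=> /le_trans; apply; rewrite addrC -lerBrDr.
- move=> s s0; rewrite RintegralD//; [|exact: iF|exact: ib].
  rewrite hF// RintegralZl//; last exact: gauss_integrable_sqr.
  by rewrite Rintegral_normal_sqr// /v; ring.
Qed.

Lemma even_mean_value_quadratic F c : continuous F ->
  (forall x, F (- x) = F x) -> gauss_integrable F ->
  (forall x s, 0 < s -> \int[normal_prob x s]_y F y = F x + c * s ^+ 2) ->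
  forall x, F x = F 0 + c / gauss_var * x ^+ 2.
Proof.
move=> cF eF iF hF; have V0 := @gauss_var_gt0 R.
suff main (G : R -> R) k : continuous G -> (forall x, G (- x) = G x) ->
    gauss_integrable G ->
    (forall x s, 0 < s -> \int[normal_prob x s]_y G y = G x + k * s ^+ 2) ->
    forall x, 0 <= x -> G 0 <= G x - k / gauss_var * x ^+ 2.
  have pos x : 0 <= x -> F x = F 0 + c / gauss_var * x ^+ 2.
    move=> x0.
    have h1 := main F c cF eF iF hF x x0.
    have : - F 0 <= - F x - (- c) / gauss_var * x ^+ 2.
      apply: (main (fun x => - F x)) => //.
      - by move=> y; apply: cvgN; exact: cF.
      - by move=> y; rewrite eF.
      - by move=> m s s0; exact: integrableN (iF m s s0).
      - move=> y s s0; under eq_Rintegral do rewrite -mulN1r.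
        rewrite RintegralZl//; last exact: iF.
        by rewrite hF//; ring.
    by rewrite !mulNr; lra.
  move=> x; have [/pos//|x0] := leP 0 x.
  by rewrite -eF pos ?sqrrN// oppr_ge0 ltW.
move=> cG eG iG hG x x0; apply/ler_addgt0Pr => e e0.
(* Slightly below the critical coefficient, by an amount that costs [e * x ^+ 2 / (1 + x ^+ 2) <= e]
   at [x]. *)
pose b := k / gauss_var - e / (1 + x ^+ 2).
have x21 : 0 < 1 + x ^+ 2 by rewrite ltr_pwDl ?sqr_ge0.
have kb : 0 < k - b * gauss_var.
  rewrite /b (_ : _ - _ = e / (1 + x ^+ 2) * gauss_var).
    by rewrite mulr_gt0// divr_gt0.
  by field; rewrite !gt_eqF.
apply: (le_trans (even_mean_value_le cG eG iG hG kb x0)).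
rewrite -subr_ge0 [leRHS](_ : _ = e / (1 + x ^+ 2)) ?divr_ge0 ?ltW//.
by rewrite /b; field; rewrite !gt_eqF.
Qed.

(** After subtraction of the linear part, [d] is additive with [d 1 = 0], hence invariant under unit
    shifts and bounded on all of [[1, +oo[]. As [d] of an integer multiple of [h] is that multiple
    of [d h], a nonzero [d h] would violate the bound. *)
Lemma additive_bounded_linear (c : R -> R) (K : R) :
  (forall h k, 0 < h -> 0 < k -> c (h + k) = c h + c k) ->
  (forall h, 1 <= h <= 2 -> `|c h| <= K) ->
  forall h, 0 < h -> c h = c 1 * h.
Proof.
move=> cD cK.
pose d h := c h - c 1 * h.
have dD h k : 0 < h -> 0 < k -> d (h + k) = d h + d k.
  by move=> h0 k0; rewrite /d cD//; ring.
have d1 : d 1 = 0 by rewrite /d mulr1 subrr.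
pose K' := K + `|c 1| * 2.
have dK h : 1 <= h <= 2 -> `|d h| <= K'.
  move=> h12; rewrite (le_trans (ler_normB _ _))// lerD ?cK//.
  by case/andP: h12 => h1 h2; rewrite normrM ler_wpM2l// ger0_norm// (le_trans _ h1).
have dn n h : 0 < h -> d (n.+1%:R * h) = n.+1%:R * d h.
  move=> h0; elim: n => [|n IH]; first by rewrite !mul1r.
  rewrite [n.+2%:R]mulrSr !mulrDl !mul1r dD ?IH//.
  by rewrite mulr_gt0.
have dshift n r : 0 < r -> d (n%:R + r) = d r.
  move=> r0; elim: n => [|n IH]; first by rewrite add0r.
  by rewrite mulrSr addrAC dD ?IH ?d1 ?addr0// ltr_wpDl.
have dbig y : 1 <= y -> `|d y| <= K'.
  move=> y1; have y0 : 0 <= y by exact: le_trans y1.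
  have /andP[t1 t2] := truncn_itv y0.
  have tpos : (0 < Num.trunc y)%N by rewrite truncn_gt0.
  (* One less than the integer part is removed, so that the remainder lies in [[1, 2]], where the
     bound is given. *)
  have E : y = (Num.trunc y).-1%:R + (y - (Num.trunc y).-1%:R) by ring.
  have T : (Num.trunc y)%:R = (Num.trunc y).-1%:R + 1 :> R.
    by rewrite -[in LHS](prednK tpos) mulrSr.
  have r12 : 1 <= y - (Num.trunc y).-1%:R <= 2.
    by move: t2; rewrite mulrSr; lra.
  rewrite E dshift ?dK//.
  by rewrite (lt_le_trans ltr01)//; case/andP: r12.
move=> h h0; apply/eqP; rewrite -subr_eq0 -/(d h); apply/negPn/negP => dh0.
have dh : 0 < `|d h| by rewrite normr_gt0.
have K0 : 0 <= K' by apply: le_trans (dK 1 _); rewrite ?normr_ge0// lexx ler1n.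
(* The first summand makes the multiple of [|d h|] exceed [K'], the second puts [n.+1%:R * h] beyond
   [1], where [dbig] applies. *)
pose n := (Num.bound (K' / `|d h|) + Num.bound h^-1)%N.
have n1 : K' / `|d h| < n.+1%:R.
  apply: lt_le_trans (archi_boundP _) _; first by rewrite divr_ge0.
  by rewrite ler_nat leqW// leq_addr.
have n2 : h^-1 < n.+1%:R.
  apply: lt_le_trans (archi_boundP _) _; first by rewrite invr_ge0 ltW.
  by rewrite ler_nat leqW// leq_addl.
have : `|d (n.+1%:R * h)| <= K'.
  by apply: dbig; rewrite -ler_pdivrMr// div1r ltW.
rewrite dn// normrM ger0_norm// leNgt => /negP; apply.
by rewrite -ltr_pdivrMr.
Qed.

End mean_value_rigidity.

(** * Brownian motion and the martingale property *)

Section joint_law.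
Local Open Scope ereal_scope.
Context d d1 d2 (T : measurableType d) (T1 : measurableType d1)
  (T2 : measurableType d2) (R : realType).
Variables (P : probability T R) (m1 : probability T1 R) (m2 : probability T2 R).
Variables (X : T -> T1) (Y : T -> T2).
Hypotheses (mX : measurable_fun setT X) (mY : measurable_fun setT Y).
Hypothesis XY : forall A B, measurable A -> measurable B ->
  P (X @^-1` A `&` Y @^-1` B) = m1 A * m2 B.

Let mXY : measurable_fun setT (fun w => (X w, Y w)).
Proof. exact: measurable_fun_pair. Qed.

(** The product measure is determined by its values on rectangles, which is what [XY] provides. *)
Lemma joint_law A : measurable A ->
  P ((fun w => (X w, Y w)) @^-1` A) = (m1 \x m2) A.
Proof.
move=> mA; apply/esym.
exact: (@product_measure_unique _ _ _ _ _ m1 m2 (image_measure P mXY)).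
Qed.

Lemma integrable_joint (h : T1 * T2 -> \bar R) : measurable_fun setT h ->
  P.-integrable setT (fun w => h (X w, Y w)) ->
  (m1 \x m2).-integrable setT h.
Proof.
move=> mh /integrableP[_ hoo]; apply/integrableP; split => //.
rewrite (_ : integral _ _ _ = \int[image_measure P mXY]_z `|h z|).
  by rewrite ge0_integral_pushforward//; exact: measurableT_comp.
by apply: eq_measure_integral => A mA _; exact/esym/joint_law.
Qed.

(** Transfer to the product law followed by Fubini. *)
Lemma integral_joint (h : T1 * T2 -> \bar R) : measurable_fun setT h ->
  P.-integrable setT (fun w => h (X w, Y w)) ->
  \int[P]_w h (X w, Y w) = \int[m1]_x \int[m2]_y h (x, y).
Proof.
move=> mh ih; rewrite (integral12_prod_meas1 (integrable_joint mh ih)).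
transitivity (\int[image_measure P mXY]_z h z).
  by rewrite integral_pushforward.
by apply: eq_measure_integral => A mA _; exact: joint_law.
Qed.

End joint_law.

(** * Laws of Brownian values and increments *)

Section brownian_laws.
Context {d : measure_display} {T : measurableType d} {R : realType}.
Variables (P : probability T R) (W : R -> T -> R).
Hypothesis BM : standard_brownian_motion P W.
Implicit Types (s t : R) (A B : set R).

Lemma bm_measurable t : 0 <= t -> measurable_fun setT (W t).
Proof. by case: BM => + _ _ _ _; exact. Qed.

Lemma bm0 w : W 0 w = 0.
Proof. by case: BM => _ + _ _ _; exact. Qed.

Lemma bm_increment_law s t B : 0 <= s -> s < t -> measurable B ->
  P ((fun w => W t w - W s w) @^-1` B) = normal_prob 0 (Num.sqrt (t - s)) B.
Proof.
move=> s0 st mB; case: BM => _ _ _ /(_ s t s0 st B mB) <- _.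
by congr (P _); apply/seteqP; split => w /=; rewrite inE.
Qed.

Lemma bm_law t B : 0 < t -> measurable B ->
  P (W t @^-1` B) = normal_prob 0 (Num.sqrt t) B.
Proof.
move=> t0 mB; rewrite -[in RHS](subr0 t) -bm_increment_law//.
by congr (P _); apply/seteqP; split => w /=; rewrite bm0 subr0.
Qed.

Lemma bm_two_increments s t A B : 0 < s -> s < t ->
  measurable A -> measurable B ->
  (P (W s @^-1` A `&` (fun w => (W t w - W s w)%R) @^-1` B) =
   normal_prob 0 (Num.sqrt s) A * normal_prob 0 (Num.sqrt (t - s)) B)%E.
Proof.
move=> s0 st mA mB.
(* The default value of [nth] supplies the third time, giving [0, s, t]. Since [W 0 = 0], the first
   increment is [W s]. The sets [A, B] are listed in the same way. *)
case: BM => _ _ _ _ /(_ 2%N (nth t [:: 0; s])) /=.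
move=> /(_ (lexx 0)) -/(_ _ (nth B [:: A])) hind.
have /hind {}hind : forall i, (i < 2)%N ->
  nth t [:: 0; s] i < nth t [:: 0; s] i.+1 by case => [|[|]].
have /hind : forall i, measurable (nth B [:: A] i) by case => [|[|]].
rewrite !big_ord_recr big_ord0 /= mul1e.
have -> : [set w | W s w - W 0 w \in A] = W s @^-1` A.
  by apply/seteqP; split => w /=; rewrite inE bm0 subr0.
have -> : [set w | W t w - W s w \in B] = (fun w => W t w - W s w) @^-1` B.
  by apply/seteqP; split => w /=; rewrite inE.
rewrite bm_law// bm_increment_law ?ltW// => <-; congr (P _).
apply/seteqP; split => [w [Aw Bw] [|[|//]] _ /=|w h].
- by rewrite inE bm0 subr0.
- by rewrite inE.
- split.
    by have := h 0%N isT; rewrite /= inE bm0 subr0.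
  by have := h 1%N isT; rewrite /= inE.
Qed.

Lemma integrable_bmP t (f : R -> R) : 0 < t -> measurable_fun setT f ->
  P.-integrable setT (fun w => (f (W t w))%:E) <->
  (normal_prob 0 (Num.sqrt t)).-integrable setT (EFin \o f).
Proof.
move=> t0 mf.
have mW : measurable_fun setT (W t : T -> measurableTypeR R).
  exact: bm_measurable (ltW t0).
have mfE : measurable_fun setT (EFin \o f) by exact/measurable_EFinP.
have E : (\int[normal_prob 0 (Num.sqrt t)]_x `|(f x)%:E| =
    \int[P]_w `|(f (W t w))%:E|)%E.
  transitivity (\int[image_measure P mW]_x `|(f x)%:E|)%E.
    by apply: eq_measure_integral => A mA _; exact/esym/bm_law.
  by rewrite ge0_integral_pushforward//; exact: measurableT_comp.
split=> /integrableP[_ h]; apply/integrableP; split.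
- exact: mfE.
- by rewrite E.
- by apply/measurable_EFinP; exact: measurableT_comp.
- by rewrite -E.
Qed.

Lemma Rintegral_bm t (f : R -> R) : 0 < t -> measurable_fun setT f ->
  P.-integrable setT (fun w => (f (W t w))%:E) ->
  \int[P]_w f (W t w) = \int[normal_prob 0 (Num.sqrt t)]_x f x.
Proof.
move=> t0 mf intf.
have mW : measurable_fun setT (W t : T -> measurableTypeR R).
  exact: bm_measurable (ltW t0).
rewrite /Rintegral; congr fine.
transitivity (\int[image_measure P mW]_x (f x)%:E)%E.
  by rewrite integral_pushforward//; exact/measurable_EFinP.
by apply: eq_measure_integral => A mA _; exact/bm_law.
Qed.

End brownian_laws.

(** * Null sets and symmetries of Gaussian integrals *)

Section gaussian_null_sets.
Context {R : realType}.
Local Notation mu := (@lebesgue_measure R).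
Implicit Types (f g F G : R -> R) (m s x y c t h : R).

Lemma normal_pdf_gt0 m s x : s != 0 -> 0 < normal_pdf m s x.
Proof.
by move=> s0; rewrite normal_pdfE// mulr_gt0 ?normal_peak_gt0 ?expR_gt0.
Qed.

(** The density is strictly positive. This turns statements valid almost surely for the law of [W s]
    into Lebesgue almost everywhere ones. *)
Lemma lebesgue_dominates_normal m s : s != 0 -> mu `<< normal_prob m s.
Proof.
move=> s0; apply/null_content_dominatesP => A mA NA0.
have mp : measurable_fun A (EFin \o normal_pdf m s).
  by apply: measurable_funTS; apply/measurable_EFinP; exact: measurable_normal_pdf.
have I0 : (\int[mu]_(x in A) `|(EFin \o normal_pdf m s) x| = 0)%E.
  rewrite -[RHS]NA0; apply: eq_integral => x _.
  by rewrite /= ger0_norm ?normal_pdf_ge0.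
have [N [mN N0 AN]] := (ae_eq_integral_abs mu mA mp).1 I0.
apply: (subset_measure0 mA mN _ N0) => x Ax; apply: AN => /= /(_ Ax)[] /eqP.
by rewrite gt_eqF// normal_pdf_gt0.
Qed.

(** A point of disagreement would come with a whole ball of disagreement, of positive measure. *)
Lemma ae_eq_continuous F G : continuous F -> continuous G ->
  ae_eq mu setT F G -> F =1 G.
Proof.
move=> cF cG [N [mN N0 FGN]] x; apply/eqP; rewrite -subr_eq0.
apply/negPn/negP => FGx.
have cFG : {for x, continuous (fun y => F y - G y)}.
  by apply: cvgB; [exact: cF|exact: cG].
have /nbhs_ballP[e /= e0 xe] : \forall y \near x, F y - G y != 0.
  exact: cvgr_neq0 cFG FGx.
have : mu (ball x e) = 0.
  apply: (subset_measure0 _ mN _ N0); first exact: measurable_ball.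
  move=> y /xe FGy; apply: FGN => /= /(_ Logic.I) E.
  by rewrite E subrr eqxx in FGy.
rewrite lebesgue_measure_ball ?ltW// => -[] /eqP.
by rewrite mulrn_eq0/= gt_eqF.
Qed.

Lemma ae_eq_integrable_normal f g m s :
  measurable_fun setT g -> (normal_prob m s).-integrable setT (EFin \o f) ->
  ae_eq mu setT f g -> (normal_prob m s).-integrable setT (EFin \o g).
Proof.
move=> mg /[dup] intf /integrableP[mf foo] fg; apply/integrableP; split.
  exact/measurable_EFinP.
rewrite (_ : integral _ _ _ =
  \int[normal_prob m s]_x `|(EFin \o f) x|)%E//.
apply: ge0_ae_eq_integral => //.
- by apply: measurableT_comp => //; exact/measurable_EFinP.
- exact: measurableT_comp.
- apply: (null_dominates_ae_eq measurableT (normal_prob_dominates m s)).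
  exact: (ae_eq_comp (fun z => `|z%:E|%E) (ae_eq_sym fg)).
Qed.

Lemma ae_eq_Rintegral_normal f g m s : measurable_fun setT f ->
  measurable_fun setT g -> ae_eq mu setT f g ->
  \int[normal_prob m s]_x f x = \int[normal_prob m s]_x g x.
Proof.
move=> mf mg fg; congr fine; apply: ae_eq_integral => //.
- exact/measurable_EFinP.
- exact/measurable_EFinP.
- apply: (null_dominates_ae_eq measurableT (normal_prob_dominates m s)).
  exact: (ae_eq_comp EFin fg).
Qed.

Lemma gauss_integrable_shift f x : measurable_fun setT f ->
  gauss_integrable f -> gauss_integrable (fun z => f (x + z)).
Proof.
move=> mf iF m s s0; have sN0 := lt0r_neq0 s0.
have ms : measurable_fun setT (fun z : R => f (x + z)).
  by apply: measurableT_comp => //; exact: measurable_funD.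
apply/(@integrable_normal_affine _ m s (EFin \o (fun z => f (x + z)))) => //.
  exact/measurable_EFinP.
have mfE : measurable_fun setT (EFin \o f) by exact/measurable_EFinP.
have := (integrable_normal_affine (x + m) sN0 mfE).1 (iF (x + m) s s0).
by under eq_fun do rewrite -addrA.
Qed.

Lemma Rintegral_normal_shift f x s : 0 < s -> measurable_fun setT f ->
  gauss_integrable f ->
  \int[normal_prob 0 s]_z f (x + z) = \int[normal_prob x s]_y f y.
Proof.
move=> s0 mf iF.
have ms : measurable_fun setT (fun z : R => f (x + z)).
  by apply: measurableT_comp => //; exact: measurable_funD.
rewrite (Rintegral_normal_affine 0 s0 ms (gauss_integrable_shift x mf iF)).
rewrite (Rintegral_normal_affine x s0 mf iF).
by apply: eq_Rintegral => z _; rewrite add0r.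
Qed.

(** Recentring at the origin and reflecting; this makes the continuous version of [f] even. *)
Lemma Rintegral_normal_even f x : (forall y, f (- y) = f y) ->
  measurable_fun setT f -> gauss_integrable f ->
  \int[normal_prob (- x) 1]_y f y = \int[normal_prob x 1]_y f y.
Proof.
move=> ev mf iF.
rewrite -(Rintegral_normal_shift (- x) ltr01 mf iF).
rewrite -(Rintegral_normal_shift x ltr01 mf iF).
have ms : measurable_fun setT (fun z : R => f (x + z)).
  by apply: measurableT_comp => //; exact: measurable_funD.
rewrite -(Rintegral_normal_opp ms (gauss_integrable_shift x mf iF)).
by apply: eq_Rintegral => z _; rewrite -ev opprD opprK.
Qed.

(** The exponential factor increases with [s], and for [s >= 1] the peak is at most twice the peak
    at deviation [2]. *)
Lemma normal_pdf_le_2 s y : 1 <= s <= 2 ->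
  normal_pdf 0 s y <= 2 * normal_pdf 0 2 y.
Proof.
move=> /andP[s1 s2]; have s0 : 0 < s by exact: lt_le_trans s1.
rewrite !normal_pdfE ?gt_eqF// mulrA; apply: ler_pM.
- exact: normal_peak_ge0.
- exact: normal_fun_ge0.
- rewrite -[X in normal_peak X]mulr1 -[X in _ <= _ * normal_peak X]mulr1.
  rewrite !normal_peakM// [leRHS]mulrC divfK// ler_pdivrMr//.
  by rewrite ler_peMr// normal_peak_ge0.
- rewrite /normal_fun subr0 ler_expR !mulNr lerN2 ler_wpM2l ?sqr_ge0//.
  rewrite lef_pV2 ?posrE ?pmulrn_lgt0 ?exprn_gt0// lerMn2r/=.
  by rewrite lerXn2r ?nnegrE// ltW.
Qed.

(** Provides the local boundedness that [additive_bounded_linear] asks for. *)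
Lemma normal_mean_bounded f : measurable_fun setT f -> gauss_integrable f ->
  exists K, forall s, 1 <= s <= 2 -> `|\int[normal_prob 0 s]_x f x| <= K.
Proof.
move=> mf iF; have iA m s : 0 < s ->
    (normal_prob m s).-integrable setT (EFin \o (fun x => `|f x|)).
  by move=> s0; exact: integrable_norm (iF m s s0).
have mA : measurable_fun setT (fun x => `|f x|) by exact: measurableT_comp.
exists (2 * \int[normal_prob 0 2]_x `|f x|) => s s12.
have s0 : 0 < s by case/andP: s12 => s1 _; exact: lt_le_trans s1.
apply: (le_trans (le_normr_Rintegral measurableT (iF 0 s s0))).
have two0 : 0 < 2 :> R by [].
have J := (integrable_normalP 0 2 mA).1 (iA 0 2 two0).
rewrite (Rintegral_normal (iA 0 s s0)) (Rintegral_normal (iA 0 2 two0)).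
rewrite -RintegralZl//; apply: le_Rintegral => //.
- exact: (integrable_normalP 0 s mA).1 (iA 0 s s0).
- exact: (integrableZl measurableT 2 J).
- by move=> y _; rewrite mulrCA ler_wpM2l// normal_pdf_le_2.
Qed.

End gaussian_null_sets.

(** * From the almost everywhere mean value property to a quadratic polynomial *)

Section almost_everywhere_mean_value.
Context {R : realType}.
Local Notation mu := (@lebesgue_measure R).
Implicit Types (x y s h k t : R).

(* [F k = f + c k] almost everywhere and [F k] is continuous, so [F 1 - c 1] is
   a continuous version of [f] that satisfies the mean value property at every
   point. *)
Lemma even_ae_mean_value_quadratic (f g : R -> R) : measurable_fun setT f ->
  (forall x, f (- x) = f x) -> gauss_integrable f ->
  (forall t, 0 < t -> g t = \int[normal_prob 0 (Num.sqrt t)]_x f x) ->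
  (forall s h, 0 < s -> 0 < h ->
    ae_eq mu setT (fun x => \int[normal_prob x (Num.sqrt h)]_y f y)
                  (fun x => f x + (g (s + h) - g s))) ->
  exists a b : R, ae_eq mu setT f (fun x => b + a * x ^+ 2).
Proof.
move=> mf ev iF gE hae.
pose c k := g (1 + k) - g 1.
pose F k x := \int[normal_prob x (Num.sqrt k)]_y f y.
have cF k : 0 < k -> continuous (F k).
  by move=> k0; apply: continuous_normal_mean => //; rewrite sqrtr_gt0.
have Fae k : 0 < k -> ae_eq mu setT (F k) (fun x => f x + c k).
  by move=> k0; exact: hae.
(* Two constants that agree almost everywhere are equal; comparing start [s] with start [1] shows
   that the increment of [g] depends on [h] only. *)
have gc s h : 0 < s -> 0 < h -> g (s + h) - g s = c h.
  move=> s0 h0.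
  have [N [mN N0 sub]] := ae_eq_trans (ae_eq_sym (hae s h s0 h0)) (Fae h h0).
  apply: (@ae_eq_continuous R (fun=> g (s + h) - g s) (fun=> c h) _ _ _ 0);
    [by move=> x; exact: cvg_cst|by move=> x; exact: cvg_cst|].
  exists N; split=> // x /= hx; apply: sub => /= hx'; apply: hx => _.
  exact: addrI (hx' Logic.I).
have cD h k : 0 < h -> 0 < k -> c (h + k) = c h + c k.
  move=> h0 k0; rewrite -(gc (1 + h) k)//; last by rewrite addr_gt0.
  by rewrite /c addrA; ring.
have [K hK] := normal_mean_bounded mf iF.
(* Variances in [[1, 4]] correspond to deviations in [[1, 2]]; the range covers [1 + k] for every
   [k] in [[1, 2]]. *)
have gK t : 1 <= t <= 4 -> `|g t| <= K.
  move=> /andP[t1 t4]; have t0 : 0 < t by exact: lt_le_trans t1.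
  rewrite gE//; apply: hK.
  rewrite -[X in X <= _]sqrtr1 ler_wsqrtr//=.
  rewrite (_ : 2 = Num.sqrt (2 ^+ 2)); last by rewrite sqrtr_sqr ger0_norm.
  by rewrite ler_wsqrtr// (le_trans t4)// -natrX.
have clin h : 0 < h -> c h = c 1 * h.
  apply: (@additive_bounded_linear R c (K + K)) => // k /andP[k1 k2].
  by rewrite (le_trans (ler_normB _ _))// lerD// gK//; lra.
pose G x := F 1 x - c 1.
have cG : continuous G.
  by move=> x; apply: cvgB; [exact: cF|exact: cvg_cst].
have mG : measurable_fun setT G by exact: continuous_measurable_fun.
have fG : ae_eq mu setT f G.
  have [N [mN N0 sub]] := Fae 1 ltr01.
  exists N; split=> // x /= hx; apply: sub => /= hx'; apply: hx => _.
  by rewrite /G hx'// addrK.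
have evG x : G (- x) = G x.
  by rewrite /G /F sqrtr1 Rintegral_normal_even.
have iG : gauss_integrable G.
  by move=> m s s0; exact: ae_eq_integrable_normal (iF m s s0) fG.
have mean x s : 0 < s -> \int[normal_prob x s]_y G y = G x + c 1 * s ^+ 2.
  move=> s0; rewrite -(ae_eq_Rintegral_normal x s mf mG fG).
  have s20 : 0 < s ^+ 2 by rewrite exprn_gt0.
  rewrite -clin//.
  (* Both sides are continuous, so the identity, known almost everywhere for time step [s ^+ 2],
     holds at every point. *)
  suff E : F (s ^+ 2) =1 (fun z => G z + c (s ^+ 2)).
    by have := E x; rewrite /F sqrtr_sqr (ger0_norm (ltW s0)).
  apply: ae_eq_continuous.
  - exact: cF.
  - by move=> z; apply: cvgD; [exact: cG|exact: cvg_cst].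
  - apply: ae_eq_trans (Fae _ s20) _.
    have [N [mN N0 sub]] := fG.
    exists N; split=> // z /= hz; apply: sub => /= hz'; apply: hz => _.
    by rewrite hz'.
exists (c 1 / gauss_var), (G 0); apply: ae_eq_trans fG _.
apply: aeW => x _.
exact: (even_mean_value_quadratic cG evG iG mean).
Qed.

End almost_everywhere_mean_value.

(** * The mean value property from the martingale property *)

Section martingale_of_function.
Context {d : measure_display} {T : measurableType d} {R : realType}.
Variables (P : probability T R) (W : R -> T -> R) (f : R -> R).
Hypothesis BM : standard_brownian_motion P W.
Hypothesis mf : measurable_fun setT f.
Hypothesis intf : forall t, 0 <= t ->
  P.-integrable setT (fun w => (f (W t w))%:E).
Local Notation mu := (@lebesgue_measure R).
Local Notation g := (fun t => \int[P]_w f (W t w)).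
Local Notation N := (fun t w => f (W t w) - g t).
Implicit Types (x y s h t : R).

Lemma gauss_integrable_of_bm : gauss_integrable f.
Proof.
apply: gauss_integrable_centered => // s s0.
have s20 : 0 < s ^+ 2 by rewrite exprn_gt0.
have := (integrable_bmP BM s20 mf).1 (intf (ltW s20)).
by rewrite sqrtr_sqr (ger0_norm (ltW s0)).
Qed.

Let X s : T -> measurableTypeR R := W s.
Let Y s h : T -> measurableTypeR R := fun w => W (s + h) w - W s w.
(** The increment of [N] from [s] to [s + h] on the event [W s \in B], written as a function of the
    independent pair [(W s, W (s + h) - W s)]. *)
Let H (B : set R) s h (z : measurableTypeR R * measurableTypeR R) : R :=
  \1_B z.1 * ((f (z.1 + z.2) - g (s + h)) - (f z.1 - g s)).
(** The defect in the mean value identity at [x], to be shown null almost everywhere. *)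
Let D s h x := \int[normal_prob x (Num.sqrt h)]_y f y - f x - (g (s + h) - g s).

Let measurable_H B s h : measurable B -> measurable_fun setT (EFin \o H B s h).
Proof.
move=> mB; apply/measurable_EFinP; apply: measurable_funM.
  by apply: measurableT_comp => //; exact: measurable_indic.
have mf' : measurable_fun setT (f : measurableTypeR R -> R) by exact: mf.
apply: measurable_funB; apply: measurable_funB => //.
  apply: (measurableT_comp mf') => /=.
  by apply: (@measurable_funD _ _ R _ fst snd).
by apply: (measurableT_comp mf').
Qed.

Let H_XY B s h w : H B s h (X s w, Y s h w) =
  \1_(W s @^-1` B) w * (N (s + h) w - N s w).
Proof.
rewrite /H /= /X /Y (addrC (W s w)) subrK !indicE.
by congr (_%:R * _); apply/idP/idP; rewrite !inE.
Qed.

Let integrable_N t : 0 <= t -> P.-integrable setT (EFin \o N t).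
Proof.
move=> t0.
exact: integrableB (intf t0) (integrable_prob_cst P (g t)).
Qed.

Let integrable_H B s h : measurable B -> 0 <= s -> 0 < h ->
  P.-integrable setT (fun w => (H B s h (X s w, Y s h w))%:E).
Proof.
move=> mB s0 h0; have t0 : 0 <= s + h by rewrite addr_ge0// ltW.
have mA : measurable (W s @^-1` B).
  by rewrite -[X in measurable X]setTI; exact: bm_measurable BM _ s0 _ _ _.
under eq_fun do rewrite H_XY//.
apply: (le_integrable _ _ _ (integrableB _ (integrable_N t0) (integrable_N s0))) => //.
  apply/measurable_EFinP; apply: measurable_funM; first exact: measurable_indic.
  apply/measurable_EFinP.
  exact: measurable_int (integrableB _ (integrable_N t0) (integrable_N s0)).
move=> w _ /=; rewrite lee_fin normrM ler_piMl//.
by rewrite indicE; case: (_ \in _); rewrite ?normr1 ?normr0.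
Qed.

(** The event [W s \in B] belongs to the past up to [s], so the martingale property can be tested on
    it. *)
Let integral_H B s h : measurable B -> 0 <= s -> 0 < h ->
  martingale P (natural_filtration W) N ->
  (\int[P]_w (H B s h (X s w, Y s h w))%:E = 0)%E.
Proof.
move=> mB s0 h0 [_ _ mart]; have t0 : 0 <= s + h by rewrite addr_ge0// ltW.
have mA : measurable (W s @^-1` B).
  by rewrite -[X in measurable X]setTI; exact: bm_measurable BM _ s0 _ _ _.
transitivity (\int[P]_(w in W s @^-1` B) ((N (s + h) w)%:E - (N s w)%:E))%E.
  rewrite [RHS]integral_mkcond; apply: eq_integral => w _.
  rewrite H_XY// patchE indicE; case: (_ \in _); rewrite ?mul1r ?mul0r//.
have iA t : 0 <= t -> P.-integrable (W s @^-1` B) (EFin \o N t).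
  by move=> tge0; apply: (integrableS measurableT) => //; exact: integrable_N.
rewrite integralB//; [|exact: iA|exact: iA].
rewrite (mart s (s + h))//.
- rewrite subee//; exact: integrable_fin_num (iA s s0).
- by rewrite lerDl ltW.
- apply: sub_sigma_algebra; exists s, B; split=> //.
  by rewrite s0 lexx.
Qed.

Let inner_integral B s h x : measurable B -> 0 < h ->
  (\int[normal_prob 0 (Num.sqrt h)]_y (H B s h (x, y))%:E =
   (\1_B x * D s h x)%:E)%E.
Proof.
move=> mB h0; have sh0 : 0 < Num.sqrt h by rewrite sqrtr_gt0.
have iF := gauss_integrable_of_bm.
have ish := gauss_integrable_shift x mf iF.
set c := - g (s + h) - (f x - g s).
have ik := gauss_integrableD ish (gauss_integrable_cst c).
have HE y : (H B s h (x, y))%:E = ((\1_B x)%:E * (f (x + y) + c)%:E)%E.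
  by rewrite -EFinM /H /= /c addrA.
under eq_integral do rewrite HE.
rewrite integralZl//; last exact: ik.
rewrite -(fineK (integrable_fin_num measurableT (ik 0 _ sh0))) -EFinM.
congr (_ * _)%:E.
rewrite -[LHS]/(\int[normal_prob 0 (Num.sqrt h)]_y (f (x + y) + c)).
rewrite RintegralD//; [|exact: ish|exact: gauss_integrable_cst].
rewrite Rintegral_prob_cst (Rintegral_normal_shift x sh0 mf iF) /D /c.
by ring.
Qed.

(** Integrating out the increment leaves [D], whose integral over every Borel set under the law of
    [W s] is therefore zero. So [D] vanishes almost surely for that law, hence Lebesgue almost
    everywhere. *)
Lemma martingale_ae_mean s h : martingale P (natural_filtration W) N ->
  0 < s -> 0 < h ->
  ae_eq mu setT (fun x => \int[normal_prob x (Num.sqrt h)]_y f y)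
                (fun x => f x + (g (s + h) - g s)).
Proof.
move=> mart s0 h0; have t0 : 0 <= s + h by rewrite addr_ge0// ltW.
have XY A B : measurable A -> measurable B ->
    (P (X s @^-1` A `&` Y s h @^-1` B) =
     normal_prob 0 (Num.sqrt s) A * normal_prob 0 (Num.sqrt h) B)%E.
  move=> mA mB; have st : s < s + h by rewrite ltrDl.
  have E : s + h - s = h by rewrite addrAC subrr add0r.
  by have := bm_two_increments BM s0 st mA mB; rewrite E.
have mX : measurable_fun setT (X s) by exact: bm_measurable BM _ (ltW s0).
have mY : measurable_fun setT (Y s h).
  apply: measurable_funB; first exact: bm_measurable BM _ t0.
  exact: bm_measurable BM _ (ltW s0).
have iD : (normal_prob 0 (Num.sqrt s)).-integrable setT (EFin \o D s h).
  have := integrable_fubini_F (integrable_joint mX mY XY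
    (measurable_H s h measurableT) (integrable_H measurableT (ltW s0) h0)).
  apply: eq_integrable => // x _.
  by rewrite /fubini_F inner_integral// indicT mul1r.
have I0 B : measurable B ->
    (\int[normal_prob 0 (Num.sqrt s)]_(x in B) (D s h x)%:E = 0)%E.
  move=> mB; rewrite -[RHS](integral_H mB (ltW s0) h0 mart).
  rewrite (integral_joint mX mY XY (measurable_H s h mB)
    (integrable_H mB (ltW s0) h0)).
  rewrite [LHS]integral_mkcond; apply: eq_integral => x _.
  rewrite inner_integral// patchE indicE.
  by case: (_ \in _); rewrite ?mul1r ?mul0r.
have := integral_ae_eq measurableT iD (measurable_cst 0%E).
have /[swap] /[apply] : forall E, E `<=` setT -> measurable E ->
    (\int[normal_prob 0 (Num.sqrt s)]_(x in E) (EFin \o D s h) x =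
     \int[normal_prob 0 (Num.sqrt s)]_(x in E) cst 0 x)%E.
  by move=> E _ mE; rewrite I0// integral0.
have ss0 : Num.sqrt s != 0 by rewrite gt_eqF// sqrtr_gt0.
move=> /(null_dominates_ae_eq measurableT (lebesgue_dominates_normal (m := 0) ss0)).
move=> [M [mM M0 sub]]; exists M; split=> // x /= hx; apply: sub => /= hD.
apply: hx => _; have [] := hD Logic.I; rewrite /D => /eqP.
by rewrite subr_eq0 subr_eq addrC => /eqP.
Qed.

End martingale_of_function.

(** * Removal of the exceptional null set along Brownian paths *)

Section brownian_paths.
Context {d : measure_display} {T : measurableType d} {R : realType}.
Variables (P : probability T R) (W : R -> T -> R).
Hypothesis BM : standard_brownian_motion P W.
Local Notation mu := (@lebesgue_measure R).
Implicit Types (x y s h t : R).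

Lemma bm_right_continuous w t : 0 <= t -> W u w @[u --> t^'+] --> W t w.
Proof.
move=> t0; case: BM => _ _ cW _ _.
have /subspace_continuousP/(_ t t0) h := cW w.
apply: cvg_trans h; apply: cvg_app => S hS.
have {}hS : \forall u \near t, 0 <= u -> S u by exact: hS.
suff : \forall u \near t, t < u -> S u by [].
by apply: filterS hS => u hu tu; apply: hu; exact: le_trans (ltW tu).
Qed.

Lemma normal_prob_itv_neq0 m s x y : s != 0 -> x < y ->
  normal_prob m s `]x, y[%classic != 0%E.
Proof.
move=> s0 xy; apply/eqP => N0.
move/null_content_dominatesP: (lebesgue_dominates_normal (m := m) s0).
move=> /(_ `]x, y[%classic (measurable_itv _) N0).
rewrite lebesgue_measure_itv/= lte_fin xy -EFinD => -[] /eqP.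
by rewrite subr_eq0 gt_eqF.
Qed.

(* [W 2 < x < W 1] has positive probability, and almost surely no [W q] with
   [q] a positive rational lies in [M]. *)
Lemma bm_hits_avoiding x (M : set R) : measurable M -> mu M = 0%E ->
  exists w t, [/\ 0 < t, W t w = x &
    forall q : rat, 0 < ratr q :> R -> ~ M (W (ratr q) w)].
Proof.
move=> mM M0.
(* [W 1] exceeds [x] by less than one and the next increment drops by more than one. The two
   conditions are independent and each has positive probability. *)
pose U : set T := W 1 @^-1` `]x, x + 1[%classic `&`
  (fun w => W 2 w - W 1 w) @^-1` `](- 2), (- 1)[%classic.
have mW1 := bm_measurable BM (@ler01 R).
have mW2 := bm_measurable BM (@ler0n R 2).
have mU : measurable U.
  apply: measurableI; rewrite -[X in measurable X]setTI.
    by apply: mW1 => //; exact: measurable_itv.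
  by apply: (measurable_funB mW2 mW1) => //; exact: measurable_itv.
have PU : P U != 0%E.
  have lt12 : 1 < 2 :> R by rewrite ltr1n.
  rewrite (bm_two_increments BM ltr01 lt12 (measurable_itv _) (measurable_itv _)).
  rewrite mule_eq0 negb_or; apply/andP; split; apply: normal_prob_itv_neq0.
  - by rewrite sqrtr1 oner_neq0.
  - by rewrite ltrDl.
  - by rewrite gt_eqF// sqrtr_gt0 subr_gt0.
  - by rewrite ltrN2.
(* The bad events at positive rational times, enumerated through the countable encoding of
   rationals; all other indices give the empty set. *)
pose Z (n : nat) : set T := if unpickle n is Some q then
  if 0 < ratr q :> R then W (ratr q) @^-1` M else set0 else set0.
have Z0 n : P.-negligible (Z n).
  rewrite /Z; case: unpickle => [q|]; last exact: negligible_set0.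
  case: ifPn => q0; last exact: negligible_set0.
  apply/negligibleP.
    by rewrite -[X in measurable X]setTI; apply: (bm_measurable BM (ltW q0)).
  rewrite [LHS](bm_law BM q0 mM).
  move/null_content_dominatesP: (normal_prob_dominates (0 : R) (Num.sqrt (ratr q))).
  exact.
have [N [mN N0 ZN]] := negligible_bigcup Z0.
have [w [Uw nZw]] : exists w, U w /\ ~ (\bigcup_n Z n) w.
  apply: contrapT => h; move/eqP: PU; apply.
  apply: (subset_measure0 mU mN _ N0) => w Uw; apply: ZN.
  by apply: contrapT => nZ; apply: h; exists w.
have q_avoid (q : rat) : 0 < ratr q :> R -> ~ M (W (ratr q) w).
  move=> q0 Mq; apply: nZw; exists (pickle q); first exact: Logic.I.
  by rewrite /Z pickleK q0.
have cW : {within `[1, 2], continuous (W ^~ w)}.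
  case: BM => _ _ /(_ w) + _ _; apply: continuous_subspaceW => u /=.
  by rewrite in_itv/= => /andP[+ _]; exact: le_trans.
move: Uw; rewrite /U /= !in_itv/= => -[/andP[x1 x2] /andP[y1 y2]].
have [] := @IVT R (W ^~ w) 1 2 x _ cW.
- by rewrite ler1n.
- have W21 : W 2 w <= W 1 w by lra.
  by rewrite (min_idPr W21) (max_idPl W21); apply/andP; split; lra.
move=> t; rewrite in_itv/= => /andP[t1 _] Wt.
by exists w, t; split=> //; exact: lt_le_trans t1.
Qed.

(** On a path that hits [x] at time [t] and avoids the null set at rational times, the error is zero
    at rationals just after [t], while by right-continuity it tends to the error at [x]. *)
Lemma right_continuous_ae_quadratic (f g : R -> R) (a b c : R) :
  ae_eq mu setT f (fun x => b + a * x ^+ 2) ->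
  (forall t, 0 < t -> g t = b + c * t) ->
  right_continuous_paths (fun t w => f (W t w) - g t) ->
  forall x, f x = b + a * x ^+ 2.
Proof.
move=> [M [mM M0 sub]] gE rc x.
have [w [t [t0 Wt q_avoid]]] := bm_hits_avoiding x mM M0.
apply/eqP; rewrite -subr_eq0; apply/negPn/negP => fx.
(* Adding [b + c * u] compensates [g], so that at a positive time [u] this is the error of the
   quadratic formula at [W u w]. *)
pose E u := f (W u w) - g u + (b + c * u) - (b + a * W u w ^+ 2).
have Et : E u @[u --> t^'+] --> f x - (b + a * x ^+ 2).
  have -> : f x - (b + a * x ^+ 2) =
      f (W t w) - g t + (b + c * t) - (b + a * W t w ^+ 2).
    by rewrite gE// subrK Wt.
  apply: cvgB; [apply: cvgD; first exact: rc (ltW t0)|].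
    apply: cvgD; first exact: cvg_cst.
    by apply: cvgM; [exact: cvg_cst|exact: cvg_at_right_filter].
  apply: cvgD; first exact: cvg_cst.
  apply: cvgM; first exact: cvg_cst.
  by apply: cvgM; exact: bm_right_continuous (ltW t0).
have := cvgr_neq0 _ Et fx.
move=> [e /= e0 he].
have /rat_in_itvoo[q] : t < t + e by rewrite ltrDl.
rewrite in_itv/= => /andP[tq qe].
have q0 : 0 < ratr q :> R by exact: lt_trans tq.
have dq : `|t - ratr q| < e by rewrite ltr0_norm ?subr_lt0// opprB ltrBlDl.
have /eqP := he (ratr q) dq tq; apply.
rewrite /E gE// subrK; apply/eqP; rewrite subr_eq0; apply/eqP.
apply: contrapT => h.
by apply: (q_avoid q q0); apply: sub => /= /(_ Logic.I).
Qed.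

Lemma martingale_quadratic (f : R -> R) : measurable_fun setT f ->
  (forall x, f (- x) = f x) -> f 0 = 0 ->
  (forall t, 0 <= t -> P.-integrable setT (fun w => (f (W t w))%:E)) ->
  let N := fun t w => f (W t w) - \int[P]_w f (W t w) in
  martingale P (natural_filtration W) N -> right_continuous_paths N ->
  exists a : R, forall x, f x = a * x ^+ 2.
Proof.
move=> mf ev f0 intf N mart rc.
have iF := gauss_integrable_of_bm BM mf intf.
have gE t : 0 < t -> \int[P]_w f (W t w) = \int[normal_prob 0 (Num.sqrt t)]_x f x.
  by move=> t0; exact: (Rintegral_bm BM t0 mf (intf _ (ltW t0))).
have [a [b fab]] := even_ae_mean_value_quadratic mf ev iF gE
  (fun s h => martingale_ae_mean BM mf intf mart).
have mq : measurable_fun setT (fun x => b + a * x ^+ 2).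
  by apply: measurable_funD => //; apply: measurable_funM => //; exact: measurable_funX.
have iq := gauss_integrableZ a (@gauss_integrable_sqr R).
(* The almost everywhere form of [f] already determines the mean, which makes it explicit and affine
   in [t]. *)
have gab t : 0 < t -> \int[P]_w f (W t w) = b + a * gauss_var * t.
  move=> t0; have st0 : 0 < Num.sqrt t by rewrite sqrtr_gt0.
  rewrite gE// (ae_eq_Rintegral_normal 0 _ mf mq fab).
  rewrite RintegralD//; [|exact: gauss_integrable_cst|exact: iq].
  rewrite RintegralZl//; last exact: gauss_integrable_sqr.
  rewrite Rintegral_normal_sqr// Rintegral_prob_cst sqr_sqrtr ?ltW//.
  by rewrite expr0n add0r mulrA.
have fE := right_continuous_ae_quadratic fab gab rc.
have b0 : b = 0 by have := fE 0; rewrite f0 expr0n mulr0 addr0.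
by exists a => x; rewrite fE b0 add0r.
Qed.

End brownian_paths.

(** * The quadratic functional equation *)

Section quadratic_functional_equation.
Context {R : realType}.
Local Notation mu := (@lebesgue_measure R).
Implicit Types (f g : R -> R) (x y h : R).

Definition quadratic_equation f :=
  forall x y, f (x + y) + f (x - y) = 2 * f x + 2 * f y.

Lemma quadratic_equation0 f : quadratic_equation f -> f 0 = 0.
Proof. by move=> qf; have := qf 0 0; rewrite addr0 subr0; lra. Qed.

Lemma quadratic_equation_even f x : quadratic_equation f -> f (- x) = f x.
Proof.
move=> qf; have := qf 0 x.
by rewrite add0r sub0r (quadratic_equation0 qf); lra.
Qed.

(** The equation at [n.+1%:R * x] and [x] is a recurrence of order two, so the induction carries two
    consecutive values. *)
Lemma quadratic_equation_natmul f x n : quadratic_equation f ->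
  f (n%:R * x) = n%:R ^+ 2 * f x.
Proof.
move=> qf; suff [] : f (n%:R * x) = n%:R ^+ 2 * f x /\
  f (n.+1%:R * x) = n.+1%:R ^+ 2 * f x by [].
elim: n => [|n [IH1 IH2]].
  by rewrite !mul0r (quadratic_equation0 qf) expr0n mul0r !mul1r expr1n mul1r.
split => //; have := qf (n.+1%:R * x) x.
have -> : n.+1%:R * x + x = n.+2%:R * x by rewrite [n.+2%:R]mulrSr; ring.
have -> : n.+1%:R * x - x = n%:R * x by rewrite [n.+1%:R]mulrSr; ring.
rewrite IH1 IH2 [n.+2%:R]mulrSr [n.+1%:R]mulrSr => E.
have -> : f ((n%:R + 1 + 1) * x) = 2 * ((n%:R + 1) ^+ 2 * f x) + 2 * f x -
  n%:R ^+ 2 * f x by rewrite -E addrK.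
by ring.
Qed.

Lemma preimage_translate_measure (C : set R) h : measurable C ->
  measurable ((fun x => h + x) @^-1` C) /\ mu ((fun x => h + x) @^-1` C) = mu C.
Proof.
move=> mC; split.
  have mt : measurable_fun setT (fun x : R => h + x) by exact: measurable_funD.
  by rewrite -[X in measurable X]setTI; exact: mt.
rewrite -(lebesgue_measure_affine h (oner_neq0 R) mC) normr1 mul1e.
by congr (mu _); apply/seteqP; split => x /=; rewrite mul1r.
Qed.

(* [f h = (f (x + h) + f (x - h)) / 2 - f x], and [x] can be chosen so that [f]
   is at most [n] at all three points, as [`|f| > n] has small measure. *)
Lemma quadratic_equation_bounded f : measurable_fun setT f ->
  quadratic_equation f -> exists M, forall h, -1 <= h <= 1 -> `|f h| <= M.
Proof.
move=> mf qf.
(* The window [[0, 3]] contains [x], [x + h] and [x - h] whenever [x] is in [[1, 2]] and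
   [|h| <= 1]. *)
pose C n : set R := `[0, 3]%classic `&` [set x | n%:R < `|f x|].
have mC n : measurable (C n).
  apply: measurableI => //.
  have mnf : measurable_fun setT (fun x => `|f x|) by exact: measurableT_comp.
  rewrite (_ : [set x | _] = setT `&` (fun x => `|f x|) @^-1` `]n%:R, +oo[%classic).
    by apply: mnf => //; exact: measurable_itv.
  by rewrite setTI; apply/seteqP; split => x /=; rewrite in_itv/= andbT.
have C0 : \bigcap_n C n = set0.
  apply/seteqP; split => // x Cx.
  have [_ /=] := Cx (Num.bound `|f x|) Logic.I.
  by rewrite ltNge ltW// archi_boundP.
have cvC : mu (C n) @[n --> \oo] --> 0%E.
  rewrite -(measure0 mu) -C0; apply: nonincreasing_cvg_mu => //.
  - apply: (@le_lt_trans _ _ (mu `[0%R, 3%R]%classic)).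
      apply: le_measure; last exact: subIsetl.
        by apply: mem_set; exact: mC.
      by apply: mem_set; exact: measurable_itv.
    by rewrite lebesgue_measure_itv/= lte_fin ltr0n/= ltry.
  - by apply: bigcapT_measurable => n; exact: mC.
  - move=> m n mn; apply/subsetPset => x [x03 /= nfx]; split => //=.
    by rewrite (le_lt_trans _ nfx)// ler_nat.
(* Three exceptional sets of measure below [1 / 4] cannot cover [[1, 2]], whose length is [1]. *)
have [n Cn] : exists n, (mu (C n) < (1 / 4)%:E)%E.
  have : \forall n \near \oo, (mu (C n) < (1 / 4)%:E)%E.
    apply: (cvC [set y | (y < (1 / 4)%:E)%E]); apply: open_nbhs_nbhs; split.
      exact: open_ereal_lt_ereal.
    by rewrite /= lte_fin.
  exact: filter_ex.
exists (n%:R + n%:R) => h h1.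
have [x [x03 Cx Cxh Cxh']] : exists x, [/\ x \in `[1, 2],
    ~ C n x, ~ C n (h + x) & ~ C n (- h + x)].
  apply: contrapT => nx.
  have [mCh Ch] := preimage_translate_measure h (mC n).
  have [mCh' Ch'] := preimage_translate_measure (- h) (mC n).
  set A := _ @^-1` _ in mCh Ch; set B := _ @^-1` _ in mCh' Ch'.
  have sub : `[1, 2]%classic `<=` (C n `|` A) `|` B.
    move=> x x12; apply: contrapT => /not_orP[/not_orP[xC xA] xB].
    by apply: nx; exists x.
  have mCA : measurable (C n `|` A) by exact: measurableU.
  have : (mu `[1%R, 2%R]%classic <= mu (C n) + mu A + mu B)%E.
    apply: (@le_trans _ _ (mu ((C n `|` A) `|` B))).
      by apply: le_measure; rewrite ?inE//; exact: measurableU.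
    apply: (le_trans (measureU2 _ _ _)) => //.
    by rewrite leeD2r//; apply: measureU2; [exact: mC|exact: mCh].
  rewrite Ch Ch' lebesgue_measure_itv/= lte_fin ltr1n/= -EFinD => h12.
  have : ((2 - 1)%:E < (1 / 4)%:E + (1 / 4)%:E + (1 / 4)%:E :> \bar R)%E.
    by apply: (le_lt_trans h12); do 2 apply: lteD => //.
  by rewrite -!EFinD lte_fin; lra.
have fn y : ~ C n y -> 0 <= y <= 3 -> `|f y| <= n%:R.
  by move=> Cy y03; rewrite leNgt; apply/negP => fy; apply: Cy; split.
move: x03; rewrite in_itv/= => /andP[x1 x2].
have b1 : `|f x| <= n%:R by apply: fn => //; lra.
have b2 : `|f (h + x)| <= n%:R by apply: fn => //; lra.
have b3 : `|f (- h + x)| <= n%:R by apply: fn => //; lra.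
have := qf x h; rewrite [x + h]addrC [x - h]addrC.
move: b1 b2 b3; rewrite !ler_norml; lra.
Qed.

Lemma measurable_quadratic_equation f : measurable_fun setT f ->
  quadratic_equation f -> forall x, f x = f 1 * x ^+ 2.
Proof.
move=> mf qf.
have [M0 hM0] := quadratic_equation_bounded mf qf.
pose g x := f x - f 1 * x ^+ 2.
have qg : quadratic_equation g.
  by move=> x y; have := qf x y; rewrite /g => E; rewrite addrACA E; ring.
pose M := M0 + `|f 1|.
have gM h : -1 <= h <= 1 -> `|g h| <= M.
  move=> h1; rewrite (le_trans (ler_normB _ _))// lerD ?hM0//.
  rewrite normrM ler_piMr// ger0_norm ?sqr_ge0//.
  by case/andP: h1 => h1 h2; nra.
have g1 : g 1 = 0 by rewrite /g expr1n mulr1 subrr.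
(* As [g 1 = 0], second differences of step one vanish, so [g] is affine along each progression of
   step one; this is [gshift]. *)
have gstep x : g (x + 1) = 2 * g x - g (x - 1).
  by have := qg x 1; rewrite g1; lra.
have gshift r m : g (m%:R + r) = g r + m%:R * (g r - g (r - 1)).
  suff [] : g (m%:R + r) = g r + m%:R * (g r - g (r - 1)) /\
    g (m.+1%:R + r) = g r + m.+1%:R * (g r - g (r - 1)) by [].
  elim: m => [|m [IH1 IH2]].
    by rewrite !add0r mul0r addr0 mul1r [1 + r]addrC gstep; split => //; ring.
  split => //; rewrite [m.+2%:R]mulrSr addrAC gstep IH2.
  have -> : m.+1%:R + r - 1 = m%:R + r by rewrite mulrSr; ring.
  by rewrite IH1 mulrSr; ring.
have gpos x : 0 < x -> g x = 0.
  move=> x0; apply/eqP; apply/negPn/negP => gx.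
  have ngx : 0 < `|g x| by rewrite normr_gt0.
  have M_ge0 : 0 <= M by apply: le_trans (gM 1 _); rewrite ?lexx//; lra.
  (* Quadratic homogeneity against linear growth: with [m <= n%:R * x] the integer part,
     [n%:R ^+ 2 * |g x|] is at most [M + m%:R * (M + M)], and one factor [n%:R] is divided out. *)
  have key (n : nat) : (0 < n)%N -> n%:R * `|g x| <= M * (1 + 2 * x).
    move=> n0; have nR : 1 <= n%:R :> R by rewrite ler1n.
    have nx0 : 0 <= n%:R * x by rewrite mulr_ge0 ?ltW// (lt_le_trans ltr01).
    have /andP[t1 t2] := truncn_itv nx0.
    set m := Num.trunc _ in t1 t2.
    pose r := n%:R * x - m%:R.
    have r01 : 0 <= r < 1 by rewrite /r; move: t2; rewrite mulrSr; lra.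
    have gr : `|g r| <= M by apply: gM; lra.
    have gr1 : `|g (r - 1)| <= M by apply: gM; lra.
    have : g (m%:R + r) = n%:R ^+ 2 * g x.
      by rewrite -quadratic_equation_natmul// /r addrC subrK.
    rewrite gshift => E.
    have : n%:R ^+ 2 * `|g x| <= M + m%:R * (M + M).
      rewrite -[n%:R ^+ 2]ger0_norm ?sqr_ge0// -normrM -E.
      rewrite (le_trans (ler_normD _ _))// lerD// normrM ger0_norm//.
      by rewrite ler_wpM2l// (le_trans (ler_normB _ _))// lerD.
    have := ler_wpM2r M_ge0 t1.
    nra.
  have := key (Num.bound (M * (1 + 2 * x) / `|g x|)).+1 isT.
  rewrite leNgt => /negP; apply; rewrite -ltr_pdivrMr//.
  apply: (@lt_trans _ _ (Num.bound (M * (1 + 2 * x) / `|g x|))%:R).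
    by apply: archi_boundP; rewrite divr_ge0// mulr_ge0//; lra.
  by rewrite ltr_nat.
move=> x; apply/eqP; rewrite -subr_eq0 -/(g x); apply/eqP.
have [x0|x0|<-] := ltgtP 0 x.
- exact: gpos.
- by rewrite -(quadratic_equation_even x qg) gpos// oppr_gt0.
- exact: quadratic_equation0.
Qed.

End quadratic_functional_equation.

(** * Independence from the past *)

Section independence_from_past.
Local Open Scope ereal_scope.
Context {d : measure_display} {T : measurableType d} {R : realType}.
Variable P : probability T R.

Lemma sigma_algebra_setI (G : set (set T)) A B :
  <<s G >> A -> <<s G >> B -> <<s G >> (A `&` B).
Proof. exact: (@measurableI _ (g_sigma_algebraType G)). Qed.

(** The measurable sets independent of the fixed event [C] form a Dynkin class, so independence on a
    generating pi-system suffices. *)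
Lemma independent_sigma_algebra (G : set (set T)) (C : set T) :
  measurable C -> setI_closed G -> G `<=` measurable ->
  (forall A, G A -> P (A `&` C) = P A * P C) ->
  forall A, <<s G >> A -> P (A `&` C) = P A * P C.
Proof.
move=> mC GI Gm GC A; rewrite -(setI_closed_g_dynkin_g_sigma_algebra GI).
pose L := [set A | measurable A /\ P (A `&` C) = P A * P C].
have dL : dynkin L.
  split; rewrite /L.
  - by split => //=; rewrite setTI probability_setT mul1e.
  - move=> B [mB BC]; split; first exact: measurableC.
    have PC : P C \is a fin_num by exact: fin_num_measure.
    rewrite setIC -setDE measureD ?ltey_eq ?PC//.
    rewrite setIC [X in _ - X]BC probability_setC// muleBl ?mul1e//.
  - move=> F tF LF; have mF n : measurable (F n) by have [] := LF n.
    split; first exact: bigcupT_measurable.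
    rewrite setI_bigcupl !measure_bigcup//; last 2 first.
    + by move=> n _; exact: measurableI.
    + exact: trivIset_setIr.
    rewrite muleC -[P C]fineK ?fin_num_measure// -nneseriesZl//.
    apply: eq_eseriesr => n _; have [_ E] := LF n.
    by rewrite muleC fineK ?fin_num_measure//; exact: E.
by move=> /(_ L (conj dL _))[]// B GB; split; [exact: Gm|exact: GC].
Qed.

Variable W : R -> T -> R.
Hypothesis BM : standard_brownian_motion P W.
Implicit Types (s t u : R).

(** Generates the information carried by the finitely many times in [l]. *)
Definition times_events (l : seq R) : set (set T) :=
  [set A | exists u B, [/\ u \in l, measurable B & A = W u @^-1` B]].

(** Rectangles in the increments, chosen to be stable under intersection and to match the product
    formula for Brownian increments. *)
Definition increment_events n (tt : nat -> R) : set (set T) :=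
  [set A | exists2 B : nat -> set R, (forall i, measurable (B i)) &
    A = \bigcap_(i in [set i | (i < n)%N])
          [set w | (W (tt i.+1) w - W (tt i) w)%R \in B i]].

Lemma increment_events_setI n tt : setI_closed (increment_events n tt).
Proof.
move=> _ _ [B mB ->] [B' mB' ->]; exists (fun i => B i `&` B' i).
  by move=> i; exact: measurableI.
rewrite -bigcapI; apply: eq_bigcapr => i _.
by apply/seteqP; split => w /=; rewrite !inE.
Qed.

(** Starting from [W 0 = 0], each [W (tt k)] is a sum of earlier increments, hence measurable for
    the sigma-algebra they generate. *)
Lemma increment_eventsP n (tt : nat -> R) k (B : set R) : tt 0%N = 0%R ->
  (k <= n)%N -> measurable B -> <<s increment_events n tt >> (W (tt k) @^-1` B).
Proof.
move=> tt0 kn mB; set G := increment_events n tt.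
suff mW : (k <= n)%N -> measurable_fun [set: g_sigma_algebraType G] (W (tt k)).
  by rewrite -[X in <<s _ >> X]setTI; exact: mW kn measurableT _ mB.
elim: k {kn} => [_|k IH kn].
  rewrite (_ : W (tt 0%N) = cst 0%R); first exact: measurable_cst.
  by apply/funext => w; rewrite tt0 (bm0 BM).
rewrite (_ : W (tt k.+1) =
    (fun w => W (tt k) w + (W (tt k.+1) w - W (tt k) w))%R); last first.
  by apply/funext => w; rewrite addrC subrK.
apply: measurable_funD; first exact: IH (ltnW kn).
move=> _ A mA; rewrite setTI; apply: sub_sigma_algebra.
exists (fun i => if i == k then A else setT).
  by move=> i; case: ifP.
apply/seteqP; split => [w Aw i /= _|w /(_ k kn)]; last by rewrite /= eqxx inE.
by case: eqP => [->|_]; rewrite inE.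
Qed.

(** On rectangles, the product formula for [n.+1] increments is that for [n] increments times one
    further factor; the pi-system argument does the rest. *)
Lemma bm_independent_increments n (tt : nat -> R) (C : set R) : tt 0%N = 0%R ->
  (forall i, (i < n.+1)%N -> (tt i < tt i.+1)%R) -> measurable C ->
  forall A, <<s increment_events n tt >> A ->
  P (A `&` [set w | (W (tt n.+1) w - W (tt n) w)%R \in C]) =
  P A * P [set w | (W (tt n.+1) w - W (tt n) w)%R \in C].
Proof.
move=> tt0 ttlt mC.
have tt_ge0 i : (i <= n.+1)%N -> (0 <= tt i)%R.
  elim: i => [|i IH] iN; first by rewrite tt0.
  by apply: (le_trans (IH (ltnW iN))); rewrite ltW// ttlt.
have mD i (B : set R) : (i <= n)%N -> measurable B ->
    measurable [set w | (W (tt i.+1) w - W (tt i) w)%R \in B].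
  move=> iN mB.
  have := measurable_funB (bm_measurable BM (tt_ge0 _ (iN : (i.+1 <= n.+1)%N)))
    (bm_measurable BM (tt_ge0 _ (leqW iN))).
  move=> /(_ measurableT B mB); rewrite setTI.
  by congr measurable; apply/seteqP; split => w /=; rewrite inE.
have [_ _ _ _ bm] := BM.
apply: independent_sigma_algebra.
- exact: mD.
- exact: increment_events_setI.
- move=> _ [B mB ->]; apply: bigcap_measurableType => i /= iN.
  by apply: mD => //; exact: ltnW.
move=> _ [B mB ->].
pose B' i := if i == n then C else B i.
have mB' i : measurable (B' i) by rewrite /B'; case: ifP.
have tt00 : (0 <= tt 0%N)%R by rewrite tt0.
have := bm n.+1 tt tt00 ttlt B' mB'; rewrite big_ord_recr /=.
have -> : \prod_(i < n) P [set w | (W (tt i.+1) w - W (tt i) w)%R \in B' i] =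
    P (\bigcap_(i in [set i | (i < n)%N])
       [set w | (W (tt i.+1) w - W (tt i) w)%R \in B i]).
  rewrite (bm n tt tt00 _ B mB); last by move=> i iN; exact: ttlt (ltnW iN).
  by apply: eq_bigr => i _; rewrite /B' ltn_eqF.
rewrite {2}/B' eqxx => <-; congr (P _); apply/seteqP; split => w.
  move=> [Bw Cw] i /=; rewrite ltnS leq_eqVlt /B' => /orP[/eqP ->|iN].
    by rewrite eqxx.
  by rewrite ltn_eqF//; exact: Bw.
move=> Bw; split => [i iN|].
  by have := Bw i (ltnW iN : (i < n.+1)%N); rewrite /= /B' ltn_eqF.
by have := Bw n (ltnSn n); rewrite /= /B' eqxx.
Qed.

Lemma times_events_independent s t (l : seq R) (C : set R) : (0 <= s)%R ->
  (s < t)%R -> (forall u, u \in l -> 0 <= u <= s)%R -> measurable C ->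
  forall A, <<s times_events l >> A ->
  P (A `&` [set w | (W t w - W s w)%R \in C]) =
  P A * P [set w | (W t w - W s w)%R \in C].
Proof.
move=> s0 st ls mC A lA.
(* Adding [0] and [s] to the list makes the sorted times start at [0] and end at [s]. *)
pose L := sort <=%R (undup (0%R :: s :: l)).
have memL u : (u \in L) = (u \in 0%R :: s :: l) by rewrite mem_sort mem_undup.
have L_itv u : u \in L -> (0 <= u <= s)%R.
  rewrite memL !inE => /or3P[/eqP ->|/eqP ->|/ls//]; first by rewrite lexx.
  by rewrite s0 lexx.
have sortedL : sorted <%R L.
  by rewrite lt_sorted_uniq_le sort_uniq undup_uniq sort_le_sorted.
have L0 : (0 < size L)%N.
  by rewrite -has_predT; apply/hasP; exists 0%R; rewrite // memL inE eqxx.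
pose n := (size L).-1; have szL : size L = n.+1 by rewrite /n prednK.
(* The default [t] is the time after the last entry, so the final increment is [W t - W s]. *)
pose tt := nth t L.
have mono i j : (i < size L)%N -> (j < size L)%N -> (i < j)%N = (tt i < tt j)%R.
  by move=> iL jL; rewrite (lt_sorted_ltn_nth t sortedL).
have mono_le i j : (i < size L)%N -> (j < size L)%N -> (i <= j)%N = (tt i <= tt j)%R.
  by move=> iL jL; rewrite (lt_sorted_leq_nth t sortedL).
have tt0 : tt 0%N = 0%R.
  have /L_itv/andP[tt00 _] : tt 0%N \in L by rewrite mem_nth.
  have i0 : (index 0%R L < size L)%N by rewrite index_mem memL inE eqxx.
  have : (tt 0%N <= tt (index 0%R L))%R by rewrite -mono_le.
  rewrite {2}/tt nth_index ?memL ?inE ?eqxx// => tt0'.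
  by apply/eqP; rewrite eq_le tt0' tt00.
have ttn : tt n = s.
  have nL : (n < size L)%N by rewrite szL.
  have /L_itv/andP[_ ttns] : tt n \in L by rewrite mem_nth.
  have sL : s \in L by rewrite memL !inE eqxx orbT.
  have is_ : (index s L < size L)%N by rewrite index_mem.
  have : (tt (index s L) <= tt n)%R by rewrite -mono_le// -ltnS -szL.
  rewrite {1}/tt nth_index// => ttn'.
  by apply/eqP; rewrite eq_le ttn' ttns.
have ttn1 : tt n.+1 = t by rewrite /tt nth_default// szL.
have ttlt i : (i < n.+1)%N -> (tt i < tt i.+1)%R.
  rewrite ltnS leq_eqVlt => /orP[/eqP ->|iN]; first by rewrite ttn ttn1.
  by rewrite -mono// szL// ltnS ltnW.
have := bm_independent_increments tt0 ttlt mC (A := A).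
rewrite ttn ttn1; apply.
apply: (smallest_sub _ _ lA); first exact: smallest_sigma_algebra.
move=> _ [u [B [ul mB ->]]].
have uL : u \in L by rewrite memL !inE ul !orbT.
have -> : u = tt (index u L) by rewrite /tt nth_index.
by apply: increment_eventsP => //; rewrite -ltnS -szL index_mem.
Qed.

(** The past is generated by the sigma-algebras of finite lists of times. Their union is a
    pi-system, since two lists can be concatenated. *)
Lemma bm_independent_past s t (A : set T) (C : set R) : (0 <= s)%R ->
  (s < t)%R -> natural_filtration W s A -> measurable C ->
  P (A `&` (fun w => W t w - W s w)%R @^-1` C) =
  P A * P ((fun w => W t w - W s w)%R @^-1` C).
Proof.
move=> s0 st FA mC.
have -> : (fun w => W t w - W s w)%R @^-1` C = [set w | (W t w - W s w)%R \in C].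
  by apply/seteqP; split => w /=; rewrite inE.
pose G := [set A | exists2 l : seq R,
  (forall u, u \in l -> 0 <= u <= s)%R & <<s times_events l >> A].
have times_mono l l' : {subset l <= l'} ->
    <<s times_events l >> `<=` <<s times_events l' >>.
  move=> ll'; apply: sub_sigma_algebra2 => _ [u [B [ul mB ->]]].
  by exists u, B; split => //; exact: ll'.
apply: (@independent_sigma_algebra G).
- have := measurable_funB (bm_measurable BM (le_trans s0 (ltW st)))
    (bm_measurable BM s0).
  move=> /(_ measurableT C mC); rewrite setTI.
  by congr measurable; apply/seteqP; split => w /=; rewrite inE.
- move=> A1 A2 [l1 l1s A1l] [l2 l2s A2l]; exists (l1 ++ l2).
    by move=> u; rewrite mem_cat => /orP[/l1s|/l2s].
  apply: sigma_algebra_setI.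
    by apply: times_mono A1l => u ul; rewrite mem_cat ul.
  by apply: times_mono A2l => u ul; rewrite mem_cat ul orbT.
- move=> A1 [l ls]; apply: smallest_sub; first exact: sigma_algebra_measurable.
  move=> _ [u [B [/ls/andP[u0 _] mB ->]]].
  by rewrite -[X in measurable X]setTI; exact: bm_measurable BM _ u0 _ _ _.
- move=> A1 [l ls lA1]; exact: times_events_independent lA1.
- apply: (sub_sigma_algebra2 _ FA) => _ [u [B [us [mB ->]]]].
  exists [:: u]; first by move=> v; rewrite inE => /eqP ->.
  by apply: sub_sigma_algebra; exists u, B; rewrite inE.
Qed.

End independence_from_past.

(** * The martingale attached to the square of Brownian motion *)

Section square_martingale.
Context {d : measure_display} {T : measurableType d} {R : realType}.
Variables (P : probability T R) (W : R -> T -> R).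
Hypothesis BM : standard_brownian_motion P W.
Implicit Types (s t u a : R).

Lemma natural_filtration_measurable s A :
  natural_filtration W s A -> measurable A.
Proof.
apply: smallest_sub; first exact: sigma_algebra_measurable.
move=> _ [u [B [/andP[u0 _] [mB ->]]]].
by rewrite -[X in measurable X]setTI; exact: bm_measurable BM _ u0 _ _ _.
Qed.

(** By independence from the past, [Z] and the increment have a product joint law, and the double
    integral factorises. *)
Lemma integral_past_increment s t (p : R -> R) (Z : T -> R) : 0 <= s -> s < t ->
  (forall B, measurable B -> natural_filtration W s (Z @^-1` B)) ->
  measurable_fun setT p -> gauss_integrable p ->
  P.-integrable setT (EFin \o Z) ->
  P.-integrable setT (fun w => (Z w * p (W t w - W s w))%:E) ->
  \int[P]_w (Z w * p (W t w - W s w)) =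
  \int[P]_w Z w * \int[normal_prob 0 (Num.sqrt (t - s))]_y p y.
Proof.
move=> s0 st FZ mp ip iZ iZp.
have sts : 0 < Num.sqrt (t - s) by rewrite sqrtr_gt0 subr_gt0.
have mZ : measurable_fun setT (Z : T -> measurableTypeR R).
  by move=> _ B mB; rewrite setTI; exact: natural_filtration_measurable (FZ _ mB).
pose Z' : {mfun T >-> measurableTypeR R} :=
  HB.pack Z (isMeasurableFun.Build _ _ _ _ _ mZ).
pose Y : T -> measurableTypeR R := fun w => W t w - W s w.
have mY : measurable_fun setT Y.
  apply: measurable_funB; first exact: bm_measurable BM _ (le_trans s0 (ltW st)).
  exact: bm_measurable BM _ s0.
have ZY A B : measurable A -> measurable B ->
    (P (Z @^-1` A `&` Y @^-1` B) =
     distribution P Z' A * normal_prob 0 (Num.sqrt (t - s)) B)%E.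
  move=> mA mB; have E := bm_independent_past BM s0 st (FZ _ mA) mB.
  by rewrite [LHS]E (bm_increment_law BM s0 st mB).
pose h (z : measurableTypeR R * measurableTypeR R) : \bar R := (z.1 * p z.2)%:E.
have mh : measurable_fun setT h.
  apply/measurable_EFinP; apply: (@measurable_funM _ _ R) => //.
  have mp' : measurable_fun setT (p : measurableTypeR R -> R) by exact: mp.
  exact: (measurableT_comp mp').
rewrite [LHS]/Rintegral.
have -> : (\int[P]_w (Z w * p (W t w - W s w))%:E = \int[P]_w h (Z w, Y w))%E by [].
rewrite (integral_joint mZ mY ZY mh iZp).
set k := \int[normal_prob 0 (Num.sqrt (t - s))]_y p y.
transitivity (fine (\int[distribution P Z']_x (x * k)%:E)%E).
  congr fine; apply: eq_integral => x _; rewrite /h /=.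
  under eq_integral do rewrite EFinM.
  rewrite integralZl//; last exact: ip.
  by rewrite EFinM /k fineK// (integrable_fin_num measurableT)//; exact: ip.
rewrite integral_distribution//; last 2 first.
- by apply/measurable_EFinP; exact: measurable_funM.
- by under eq_fun do rewrite EFinM; exact: integrableZr.
by rewrite -RintegralZr.
Qed.

Lemma integrable_bm_sqr t : 0 <= t ->
  P.-integrable setT (fun w => (W t w ^+ 2)%:E).
Proof.
rewrite le_eqVlt => /orP[/eqP <-|t0].
  apply: (eq_integrable _ (cst 0%E)) => //; last exact: integrable0.
  by move=> w _; rewrite (bm0 BM) expr0n.
have mX : measurable_fun setT (fun x : R => x ^+ 2) by exact: measurable_funX.
apply/(integrable_bmP BM t0 mX)/gauss_integrable_sqr.
by rewrite sqrtr_gt0.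
Qed.

Lemma Rintegral_bm_sqr t : 0 <= t ->
  \int[P]_w (W t w ^+ 2) = gauss_var * t.
Proof.
rewrite le_eqVlt => /orP[/eqP <-|t0].
  under eq_Rintegral do rewrite (bm0 BM) expr0n.
  by rewrite Rintegral_prob_cst mulr0.
have mX : measurable_fun setT (fun x : R => x ^+ 2) by exact: measurable_funX.
rewrite (Rintegral_bm BM t0 mX (integrable_bm_sqr (ltW t0))).
by rewrite Rintegral_normal_sqr ?sqrtr_gt0// expr0n add0r sqr_sqrtr// ltW.
Qed.

(** Expands [W t ^+ 2 - W s ^+ 2] as the squared increment plus [2 * W s] times the increment. The
    cross term integrates to zero, because the increment is centred and independent of the past. *)
Lemma martingale_increment_sqr s t A : 0 <= s -> s < t ->
  natural_filtration W s A ->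
  \int[P]_w (\1_A w * (W t w ^+ 2 - W s w ^+ 2)) =
  gauss_var * (t - s) * fine (P A).
Proof.
move=> s0 st FA; have t0 : 0 <= t by exact: le_trans (ltW st).
have mA := natural_filtration_measurable FA.
have mWs := bm_measurable BM s0; have mWt := bm_measurable BM t0.
have mY : measurable_fun setT (fun w => W t w - W s w) by exact: measurable_funB.
have sts : 0 < Num.sqrt (t - s) by rewrite sqrtr_gt0 subr_gt0.
(* The sample space with the past as its sigma-algebra, so that the usual closure rules for
   measurable functions yield measurability with respect to the past. *)
pose past : measurableType _ := g_sigma_algebraType
  [set A | exists u B, 0 <= u <= s /\ measurable B /\ A = W u @^-1` B].
have past1 : measurable_fun [set: past] (\1_A : T -> R).
  by apply: measurable_indic; exact: FA.
have pastW : measurable_fun [set: past] (W s).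
  move=> _ B mB; rewrite setTI; apply: sub_sigma_algebra.
  by exists s, B; rewrite s0 lexx.
(* A common integrable bound for the squared increment and the cross term. *)
have iS := integrableD measurableT (integrableZl measurableT 3 (integrable_bm_sqr s0))
  (integrableZl measurableT 3 (integrable_bm_sqr t0)).
have m1 : measurable_fun setT (\1_A : T -> R) by exact: measurable_indic.
have i1 : P.-integrable setT (EFin \o \1_A) by exact: integrable_indic.
have ind w : `|\1_A w| <= 1 :> R.
  by rewrite indicE; case: (_ \in _); rewrite ?normr1 ?normr0.
have iY2 : P.-integrable setT (fun w => (\1_A w * (W t w - W s w) ^+ 2)%:E).
  apply: (le_integrable _ _ _ iS) => //.
    by apply/measurable_EFinP; apply: measurable_funM => //; exact: measurable_funX.
  move=> w _ /=; rewrite lee_fin [leRHS]ger0_norm; last first.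
    by rewrite addr_ge0// mulr_ge0// sqr_ge0.
  rewrite normrM (le_trans (ler_piMl _ (ind w)))// ger0_norm ?sqr_ge0//.
  by have := sqr_ge0 (W t w + W s w); nra.
have iZ : P.-integrable setT (fun w => (\1_A w * W s w)%:E).
  apply: (le_integrable _ _ _
    (integrableD measurableT (integrable_prob_cst P 1) (integrable_bm_sqr s0))) => //.
    by apply/measurable_EFinP; exact: measurable_funM.
  move=> w _ /=; rewrite lee_fin [leRHS]ger0_norm ?addr_ge0 ?sqr_ge0//.
  rewrite normrM (le_trans (ler_piMl _ (ind w)))// ler_norml.
  by apply/andP; split; nra.
have iZY : P.-integrable setT (fun w => (\1_A w * W s w * (W t w - W s w))%:E).
  apply: (le_integrable _ _ _ iS) => //.
    apply/measurable_EFinP; apply: measurable_funM => //; exact: measurable_funM.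
  move=> w _ /=; rewrite lee_fin [leRHS]ger0_norm; last first.
    by rewrite addr_ge0// mulr_ge0// sqr_ge0.
  rewrite -mulrA normrM (le_trans (ler_piMl _ (ind w)))// ler_norml.
  by apply/andP; split; nra.
have E1 : \int[P]_w (\1_A w * (W t w - W s w) ^+ 2) =
    gauss_var * (t - s) * fine (P A).
  have F1 (B : set R) : measurable B -> natural_filtration W s (\1_A @^-1` B).
    by move=> mB; have := past1 measurableT B mB; rewrite setTI.
  have mX : measurable_fun setT (fun y : R => y ^+ 2) by exact: measurable_funX.
  rewrite (integral_past_increment s0 st F1 mX (@gauss_integrable_sqr R) i1 iY2).
  rewrite Rintegral_normal_sqr// expr0n add0r sqr_sqrtr ?subr_ge0 ?ltW//.
  by rewrite mulrC /Rintegral integral_indic// setIT.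
have E2 : \int[P]_w (\1_A w * W s w * (W t w - W s w)) = 0.
  have F2 (B : set R) : measurable B ->
      natural_filtration W s ((fun w => \1_A w * W s w) @^-1` B).
    have past2 : measurable_fun [set: past] (fun w => \1_A w * W s w).
      exact: measurable_funM.
    by move=> mB; have := past2 measurableT B mB; rewrite setTI.
  rewrite (integral_past_increment s0 st F2 (@measurable_id _ _ _)
    (@gauss_integrable_id R) iZ iZY).
  by rewrite Rintegral_normal_id// mulr0.
under eq_Rintegral => w _.
  rewrite (_ : _ * _ = \1_A w * (W t w - W s w) ^+ 2 +
    2 * (\1_A w * W s w * (W t w - W s w))); last by ring.
  over.
rewrite RintegralD//; last exact: (integrableZl measurableT 2 iZY).
by rewrite RintegralZl// E1 E2 mulr0 addr0.
Qed.

Lemma square_martingale a :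
  let f := fun x => a * x ^+ 2 in
  let N := fun t w => f (W t w) - \int[P]_w f (W t w) in
  [/\ forall t, 0 <= t -> P.-integrable setT (fun w => (f (W t w))%:E),
      martingale P (natural_filtration W) N & right_continuous_paths N].
Proof.
move=> f N.
have mf : measurable_fun setT f.
  by apply: measurable_funM => //; exact: measurable_funX.
have intf t : 0 <= t -> P.-integrable setT (fun w => (f (W t w))%:E).
  by move=> t0; exact: (integrableZl measurableT a (integrable_bm_sqr t0)).
have gE t : 0 <= t -> \int[P]_w f (W t w) = a * gauss_var * t.
  move=> t0; rewrite RintegralZl//; last exact: integrable_bm_sqr.
  by rewrite Rintegral_bm_sqr// mulrA.
have iN t : 0 <= t -> P.-integrable setT (fun w => (N t w)%:E).
  by move=> t0; exact: integrableB (intf t t0) (integrable_prob_cst P _).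
split; [exact: intf|split; [|exact: iN|]|].
- move=> t t0 B mB; apply: sub_sigma_algebra.
  exists t, ((fun x => f x - \int[P]_w f (W t w)) @^-1` B); split.
    by rewrite t0 lexx.
  split => //; rewrite -[X in measurable X]setTI.
  by apply: (measurable_funB mf (measurable_cst _)).
- move=> s t s0; rewrite le_eqVlt => /orP[/eqP -> //|st] A FA.
  have t0 : 0 <= t by exact: le_trans (ltW st).
  have mA := natural_filtration_measurable FA.
  have iA u : 0 <= u -> P.-integrable A (fun w => (N u w)%:E).
    by move=> u0; apply: (integrableS measurableT) => //; exact: iN.
  have iD := integrableB measurableT (iN t t0) (iN s s0).
  (* Both integrals are finite, so a zero difference gives equality in the extended reals. *)
  suff : (\int[P]_(w in A) (N t w)%:E - \int[P]_(w in A) (N s w)%:E = 0)%E.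
    have := integrable_fin_num mA (iA t t0); have := integrable_fin_num mA (iA s s0).
    move: (integral _ _ _) (integral _ _ _) => [x| |] [y| |]//= _ _ [] /eqP.
    by rewrite subr_eq0 => /eqP ->.
  rewrite -integralB//; [|exact: iA|exact: iA].
  have m1 : measurable_fun setT (\1_A : T -> R) by exact: measurable_indic.
  have i1 : P.-integrable setT (EFin \o \1_A) by exact: integrable_indic.
  have iI : P.-integrable setT
      (fun w => (\1_A w * (W t w ^+ 2 - W s w ^+ 2))%:E).
    have iB := integrableB measurableT (integrable_bm_sqr t0) (integrable_bm_sqr s0).
    apply: (le_integrable _ _ _ iB) => //.
      apply/measurable_EFinP; apply: measurable_funM => //.
      by apply/measurable_EFinP; exact: measurable_int iB.
    move=> w _ /=; rewrite lee_fin normrM ler_piMl//.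
    by rewrite indicE; case: (_ \in _); rewrite ?normr1 ?normr0.
  (* The compensator: minus the growth of the mean of [f (W u)] from [s] to [t]. *)
  pose c := - (a * gauss_var * (t - s)).
  have iaI := integrableZl measurableT a iI.
  have ic1 := integrableZl measurableT c i1.
  transitivity (\int[P]_w
      (a * (\1_A w * (W t w ^+ 2 - W s w ^+ 2)) + c * \1_A w)%:E)%E.
    rewrite [LHS]integral_mkcond; apply: eq_integral => w _.
    rewrite patchE /N !gE// indicE; case: (_ \in _); last first.
      by rewrite mul0r !mulr0 addr0.
    by rewrite mul1r mulr1 -EFinB /f /c; congr EFin; ring.
  rewrite -(fineK (integrable_fin_num measurableT (integrableD measurableT iaI ic1))).
  rewrite -[fine _]/(\int[P]_w
    (a * (\1_A w * (W t w ^+ 2 - W s w ^+ 2)) + c * \1_A w)).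
  rewrite RintegralD// !RintegralZl// martingale_increment_sqr//.
  rewrite [X in c * X]/Rintegral integral_indic// setIT /c.
  by congr EFin; ring.
- move=> w t t0; apply: cvgB.
    apply: cvgM; first exact: cvg_cst.
    by apply: cvgM; exact: (bm_right_continuous BM).
  rewrite gE//.
  (* The formula for the mean holds at nonnegative times, which contain all times to the right of
     [t]. *)
  apply: (@cvg_trans _ (a * gauss_var * u @[u --> t^'+])).
    apply: near_eq_cvg; near=> u; rewrite gE//.
    by apply: (le_trans t0); apply: ltW; near: u; exact: nbhs_right_gt.
  by apply: cvgM; [exact: cvg_cst|exact: cvg_at_right_filter].
Unshelve. all: by end_near.
Qed.

End square_martingale.

(** * The equivalences, obtained through the square form *)

Theorem theorem3 (d : measure_display) (T : measurableType d) (R : realType)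
  (P : probability T R) (W : R -> T -> R) (f : R -> R) :
  measure_is_complete P ->
  standard_brownian_motion P W ->
  let (* (i) *) quadratic :=
    measurable_fun setT f /\
    (forall x y, f (x + y) + f (x - y) = 2 * f x + 2 * f y) in
  let (* (ii) *) mart :=
    [/\ measurable_fun setT f, (forall x, f (- x) = f x), f 0 = 0,
        (forall t, 0 <= t -> P.-integrable setT (fun w => (f (W t w))%:E))
      & let N := fun t w => f (W t w) - Rintegral P setT (fun w => f (W t w)) in
        martingale P (natural_filtration W) N /\ right_continuous_paths N] in
  let (* (iii) *) square := exists a : R, forall x, f x = a * x ^+ 2 in
  (quadratic <-> mart) /\ (mart <-> square).
Proof.
move=> _ BM quadratic mart square.
have quadratic_square : quadratic -> square.
  by move=> [mf qf]; exists (f 1); exact: measurable_quadratic_equation.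
have mart_square : mart -> square.
  by move=> [mf ev f0 intf [martN rcN]]; exact: (martingale_quadratic BM mf ev f0).
have square_f : square -> exists a : R, f = fun x => a * x ^+ 2.
  by move=> [a fE]; exists a; apply/funext.
have square_quadratic : square -> quadratic.
  move=> /square_f[a fE]; rewrite /quadratic fE; split; last by move=> x y; ring.
  by apply: measurable_funM => //; exact: measurable_funX.
have square_mart : square -> mart.
  move=> sq; have [mf _] := square_quadratic sq.
  have [a fE] := square_f sq; have [intf martN rcN] := square_martingale BM a.
  split; first exact: mf.
  - by move=> x; rewrite fE sqrrN.
  - by rewrite fE expr0n mulr0.
  - by rewrite fE.
  - by rewrite fE.
split; first by split=> [/quadratic_square/square_mart|/mart_square/square_quadratic].
by split.
Qed.
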